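(* Let $K$ be one of the $9$ imaginary quadratic fields of class number $1$, i.e. one of the fields $K=\mathbb{Q}(\sqrt{d_K})$ with discriminant $d_K\in\{-3,-4,-7,-8,-11,-19,-43,-67,-163\}$, let $\mathcal{O}_K$ be its maximal order, and let $p_{\mathsf{ram}}$ be its ramified prime, which is the unique rational prime that divides $d_K$. Then the Dirichlet series generating function for the number of similar sublattices of $\mathcal{O}_K$ is $D_{\mathcal{O}_K}(s)=\zeta_K(s)$, where $\zeta_K$ is the Dedekind zeta function of $K$, $$\zeta_K(s)=\prod_{p}\frac{1}{(1-p^{-s})(1-\chi(p)p^{-s})}=\prod_{\chi(p)=0}\frac{1}{1-p^{-s}}\prod_{\chi(p)=-1}\frac{1}{1-p^{-2s}}\prod_{\chi(p)=1}\frac{1}{(1-p^{-s})^2},$$ the products running over rational primes $p$. Moreover, the generating function for the primitive similar sublattices of $\mathcal{O}_K$ is $$D^{\mathsf{pr}}_{\mathcal{O}_K}(s)=\frac{D_{\mathcal{O}_K}(s)}{\zeta(2s)}=(1+p_{\mathsf{ram}}^{-s})\prod_{p\text{ splits}}\frac{1+p^{-s}}{1-p^{-s}},$$ where the product runs over all rational primes $p$ that split in the extension from $\mathbb{Q}$ to $K$. The same generating functions also apply to any planar lattice $\Gamma$ that is similar to $\mathcal{O}_K$.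
   Context: A planar lattice is a co-compact discrete subgroup of $\mathbb{C}\cong\mathbb{R}^2$; the maximal order $\mathcal{O}_K$ (ring of integers) of an imaginary quadratic field $K\subset\mathbb{C}$ is regarded as a planar lattice. Two planar lattices $\Gamma,\Gamma'$ are similar if $\Gamma'=a\Gamma$ for some $0\neq a\in\mathbb{C}$. A similar sublattice (SSL) of $\Gamma$ is a sublattice of the form $a\Gamma\subset\Gamma$ with $0\neq a\in\mathbb{C}$. A sublattice $\Lambda$ of $\Gamma$ is primitive in $\Gamma$ if $x\Lambda\subset\Gamma$ with $x\in\mathbb{Q}$ implies $x\in\mathbb{Z}$. Let $f(m)$ (respectively $f^{\mathsf{pr}}(m)$) be the number of distinct SSLs (respectively primitive SSLs) of $\Gamma$ of index $m$, and put $D_\Gamma(s):=\sum_{m\ge1}f(m)m^{-s}$ and $D^{\mathsf{pr}}_\Gamma(s):=\sum_{m\ge1}f^{\mathsf{pr}}(m)m^{-s}$; these converge absolutely at least for $\mathrm{Re}(s)>2$. $\zeta$ is the Riemann zeta function. The character $\chi=\chi_{d_K}$ is the totally multiplicative function with $\chi(1)=1$ and, for a rational prime $p$: $\chi(p)=0$ if $p\mid d_K$; $\chi(p)$ is the Legendre symbol $\bigl(\frac{d_K}{p}\bigr)$ if $p\neq2$, $p\nmid d_K$; and for $p=2\nmid d_K$, $\chi(2)=1$ if $d_K\equiv1\pmod 8$ and $\chi(2)=-1$ if $d_K\equiv5\pmod 8$. The prime $p$ ramifies, is inert, or splits in $K$ according to whether $\chi(p)$ is $0$, $-1$ or $1$.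 *)

(* Defs.v *)
(* MathComp-Analysis, with R[i] over an arbitrary R : realType as the complex
   numbers. *)
From HB Require Import structures.
From mathcomp Require Import all_boot all_order all_algebra.
From mathcomp Require Import all_classical all_reals all_analysis.
From mathcomp Require Import complex finmap.

Set Implicit Arguments.
Unset Strict Implicit.
Unset Printing Implicit Defensive.
Import Order.TTheory GRing.Theory Num.Theory.
Import numFieldNormedType.Exports.

Local Open Scope classical_set_scope.
Local Open Scope card_scope.
Local Open Scope ring_scope.

(* The library puts the norm topology on K^o for a numFieldType K; R[i] itself
   does not inherit it. *)
#[warning="-redundant-canonical-projection"]
HB.instance Definition _ (R : realType) := NormedModule.copy R[i] R[i]^o.

Section Lattices.
Variable R : realType.
Local Notation C := R[i].
Implicit Types (G L K O I : set C) (a z : C).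

Definition additive_subgroup G : Prop :=
  G 0 /\ forall x y, G x -> G y -> G (x - y).

(* Co-compactness is expressed by a compact set meeting every coset of G. *)
Definition planar_lattice G : Prop :=
  [/\ additive_subgroup G,
      forall x, G x -> isolated G x
    & exists2 F : set C, compact F &
        forall z, exists2 w, F w & G (z - w)].

Definition dilate a G : set C := [set a * z | z in G].

Definition similar_lattices G L : Prop := exists2 a, a != 0 & L = dilate a G.

Definition cosets G L : set (set C) := [set [set x + y | y in L] | x in G].

Definition has_index G L (m : nat) : Prop := cosets G L #= `I_m.

Definition is_ssl G L : Prop := L `<=` G /\ similar_lattices G L.

Definition primitive_in G L : Prop :=
  forall x : rat, dilate (ratr x) L `<=` G -> x \is a Num.int.

(* fset_set sends infinite sets to the empty set; it is applied below only to
   sets of sublattices (or ideals) of a given index in a planar lattice, which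
   are finite. *)
Definition num_sets (S : set (set C)) : nat := #|` fset_set S|%fset.

Definition num_ssl G (m : nat) : nat :=
  num_sets [set L | is_ssl G L /\ has_index G L m].

Definition num_primitive_ssl G (m : nat) : nat :=
  num_sets [set L | [/\ is_ssl G L, primitive_in G L & has_index G L m]].

Definition quadratic_field (d : int) : set C :=
  [set z | exists a b : rat, z = ratr a + ratr b * sqrtC d%:~R].

Definition ring_of_integers K : set C :=
  [set z | K z /\ integralOver (intr : int -> C) z].

Definition nonzero_ideal O I : Prop :=
  [/\ I `<=` O, additive_subgroup I, (forall x y, O x -> I y -> I (x * y))
    & exists2 x, I x & x != 0].

Definition num_ideals O (m : nat) : nat :=
  num_sets [set I | nonzero_ideal O I /\ has_index O I m].

End Lattices.

Arguments quadratic_field R d : clear implicits.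

Section Series.
Variable R : realType.
Local Notation C := R[i].
Implicit Types (s z : C) (a : nat -> nat).

Definition cexp z : C :=
  (expR (complex.Re z))%:C%C * (cos (complex.Im z) +i* sin (complex.Im z))%C.

(* n to the complex power s, for n > 0 *)
Definition cpow (n : nat) s : C := cexp (s * (ln n%:R)%:C%C).

(* Partial sums of \sum_(m >= 1) a(m) m^(-s). *)
Definition dirichlet_series a s : nat -> C :=
  series (fun k => (a k.+1)%:R * cpow k.+1 (- s)).

Definition dirichlet_sum a s : C := limn (dirichlet_series a s).

Definition zeta s : C := dirichlet_sum (fun=> 1%N) s.

(* The sum of N(I)^(-s) over the nonzero ideals I of O, grouped by the absolute
   norm N(I) = [O : I]. *)
Definition dedekind_zeta (O : set C) s : C := dirichlet_sum (num_ideals O) s.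

Definition D_ssl (G : set C) s : C := dirichlet_sum (num_ssl G) s.

Definition D_primitive_ssl (G : set C) s : C :=
  dirichlet_sum (num_primitive_ssl G) s.

(* Partial products, over the primes p < n satisfying P. *)
Definition euler_product (P : pred nat) (F : nat -> C) : nat -> C :=
  fun n => \prod_(0 <= p < n | prime p && P p) F p.

Definition prime_prod (P : pred nat) (F : nat -> C) : C :=
  limn (euler_product P F).

End Series.

Definition legendre (a : int) (p : nat) : int :=
  if (p%:Z %| a)%Z then 0
  else if [exists x : 'I_p, (x%:Z ^+ 2 == a %[mod p%:Z])%Z] then 1 else -1.

(* An odd discriminant d is 1 or 5 modulo 8. *)
Definition chi_prime (d : int) (p : nat) : int :=
  if (p%:Z %| d)%Z then 0
  else if p == 2%N then (if (d %% 8)%Z == 1 then 1 else -1)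
  else legendre d p.

Definition chi (d : int) (n : nat) : int :=
  if n is 0%N then 0
  else \prod_(q <- prime_decomp n) chi_prime d q.1 ^+ q.2.

Definition ramifies (d : int) (p : nat) : bool := chi d p == 0.
Definition inert (d : int) (p : nat) : bool := chi d p == -1.
Definition splits (d : int) (p : nat) : bool := chi d p == 1.

(* Main.v *)
Require Import Defs.
From mathcomp Require Import all_boot all_order all_algebra all_field.
From mathcomp Require Import all_classical all_reals all_analysis.
From mathcomp Require Import complex finmap.
From mathcomp Require Import ring lra zify.

(** Each of the nine rings of integers O is principal, so that its similar
    sublattices are its nonzero ideals, and all the series of the theorem count
    the ideals of O by their norm.

    Write O = Z + Z w with w + conj w = t, w conj w = n and d = t - 4 n; the
    norm of x + y w is then x^2 + t x y + n y^2 ([ring_of_integersE]). A similar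
    sublattice is a O for some nonzero a in O, and its index is the norm N(a) of
    a ([index_principal]): the index is multiplicative along chains of lattices
    and invariant under conjugation, hence [O : a O]^2 = [O : N(a) O] = N(a)^2.
    An ideal is generated by any of its shortest elements ([order_pid]); an
    element of the ideal outside the lattice so generated would produce a prime
    p with 3 p^2 <= |d| that divides a value of the norm form at (x, 1), and a
    finite computation excludes this for the nine discriminants.

    Let f(m) be the number of ideals of norm m. A prime p is either inert, or of
    the form N(pi), where the conjugate of pi is associated with pi exactly when
    p ramifies. Counting the ideals of norm p m that are divisible by pi, by its
    conjugate, and by both gives the Hecke recurrence
      f(p m) = (1 + chi(p)) f(m) - chi(p) f(m / p),
    where f(m / p) = 0 if p does not divide m ([hecke_principal]). With
    X = p^(-s), it says that multiplying the Dirichlet series of f by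
    (1 - X) (1 - chi(p) X) cancels exactly the terms of index divisible by p.
    Sieving by all the primes in turn leaves the term 1, which is the Euler
    product of D ([hecke_euler]). The recurrence also bounds f by the number of
    divisors, whence absolute convergence for Re s > 1 ([cvg_wt_hecke]).

    The same sieve ([sieve_limit]), applied to the integers whose prime factors
    lie in a given set of primes, yields the convergence of all the other
    products, with nonzero limits ([euler_product_cvg]). Applied to ideals,
    removing those divisible by a rational prime p multiplies the series by
    1 - p^(-2 s), and what remains in the limit is the series of the primitive
    sublattices: it is D / zeta(2 s) ([hecke_primitive]). The displayed products
    are then compared factor by factor ([euler_formulas]), and dilation carries
    the counts from O to every lattice similar to O. *)

Set Implicit Arguments.
Unset Strict Implicit.
Unset Printing Implicit Defensive.
Import Order.TTheory GRing.Theory Num.Theory.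
Import numFieldNormedType.Exports.
Local Open Scope classical_set_scope.
Local Open Scope card_scope.
Local Open Scope ring_scope.

(** * Absolutely convergent Dirichlet series *)
Section ComplexSeries.
Variable R : realType.
Local Notation C := R[i].
Implicit Types (u : nat -> C) (s z l : C).
Import complex.

Lemma gtC0 (e : C) : 0 < e -> exists2 r : R, 0 < r & e = r%:C%C.
Proof.
case: e => a b; rewrite ltcE /= => /andP[/eqP b0 a0]; exists a => //; by rewrite b0.
Qed.

Lemma normi : `|'i%C : C| = 1.
Proof. by rewrite normc_def /= expr0n expr1n add0r sqrtr1. Qed.

(** The norm of R[i] takes its values in R[i]; convergence is therefore brought
    back to R, where absolutely convergent series converge. *)
Lemma cvgC_ReIm u (x y : R) : (fun n => Re (u n)) @ \oo --> x ->
  (fun n => Im (u n)) @ \oo --> y -> u @ \oo --> (x +i* y)%C.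
Proof.
move=> /cvgrPdist_lt ux /cvgrPdist_lt uy; apply/cvgrPdist_lt => e /gtC0 [r r0 ->].
have r2 : 0 < r / 2 by rewrite divr_gt0.
near=> n.
have -> : (x +i* y)%C - u n = (x - Re (u n))%:C%C + 'i%C * (y - Im (u n))%:C%C.
  case: (u n) => a b; rewrite /= ; apply/eqP; rewrite eq_complex /=.
  by rewrite !(mul0r,mulr0,mul1r,mulr1,subr0,addr0,add0r,sub0r,oppr0) !eqxx.
apply: le_lt_trans (ler_normD _ _) _.
rewrite normrM.
rewrite normi mul1r !normc_def /= expr0n !addr0 !sqrtr_sqr -rmorphD ltcR (splitr r).
by apply: ltrD; near: n; [exact: ux|exact: uy].
Unshelve. all: by end_near. Qed.

(** k ^ (-a), the absolute value of k ^ (-s) on the line Re s = a. *)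
Definition wt (a : R) (k : nat) : R := expR (- a * ln k%:R).

Lemma wt_gt0 a k : 0 < wt a k. Proof. exact: expR_gt0. Qed.

Lemma wt1 a : wt a 1 = 1. Proof. by rewrite /wt ln1 mulr0 expR0. Qed.

Lemma wtM a j k : (0 < j)%N -> (0 < k)%N -> wt a (j * k) = wt a j * wt a k.
Proof.
move=> j0 k0; rewrite /wt -expRD natrM lnM ?posrE ?ltr0n //.
by rewrite mulrDr.
Qed.

Lemma le_wt a j k : 0 <= a -> (0 < j <= k)%N -> wt a k <= wt a j.
Proof.
move=> a0 /andP[j0 jk]; rewrite ler_expR !mulNr lerN2 ler_wpM2l//.
by rewrite ler_ln ?posrE ?ltr0n ?ler_nat// (leq_trans j0).
Qed.

Lemma wt2_lt a : 1 < a -> 2 * wt a 2 < 1.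
Proof.
move=> a1; rewrite -ltr_pdivlMl// mulr1 /wt.
have l2 : 0 < ln (2 : R) by rewrite ln_gt0// ltr1n.
apply: (@lt_le_trans _ _ (expR (- ln 2))).
  by rewrite ltr_expR mulNr ltrN2 ltr_pMl.
by rewrite expRN lnK// posrE.
Qed.

(** Absolute convergence, on the line Re s = a, of the Dirichlet series with
    coefficients b. *)
Definition cvg_wt (b : nat -> nat) (a : R) :=
  cvgn (series (fun k => (b k.+1)%:R * wt a k.+1)).

(** Bounding the terms of index 2 k and 2 k + 1 by that of index 2 k gives
    S(2 N + 1) <= 1 + r S(N) with r = 2 ^ (1 - a) < 1, and S(N) <= S(2 N + 1). *)
Lemma wtS_bounded a (N : nat) : 1 < a ->
  \sum_(0 <= k < N) wt a k.+1 <= (1 - 2 * wt a 2)^-1.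
Proof.
move=> a1; have r1 := wt2_lt a1; set r := 2 * wt a 2 in r1 *.
set S := fun N => \sum_(0 <= k < N) wt a k.+1.
have S2 : S (N.*2.+1) <= 1 + r * S N.
  elim: N => [|N IH]; first by rewrite /S big_nat1 big_nil wt1 mulr0 addr0.
  rewrite /S doubleS big_nat_recr//= big_nat_recr//= -/(S _).
  rewrite [in leRHS]big_nat_recr//= -/(S N) mulrDr addrA -addrA lerD// /r.
  have -> : wt a N.*2.+2 = wt a 2 * wt a N.+1 by rewrite -wtM// mul2n.
  rewrite -mulrA mulr_natl mulr2n lerD2l -wtM// mul2n doubleS.
  by apply: le_wt; [exact: le_trans ler01 (ltW a1)|rewrite /= leqnSn].
have SS : S N <= S N.*2.+1.
  rewrite /S (@big_cat_nat _ _ _ N 0 N.*2.+1)//=; last first.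
    by rewrite -addnn -addnS leq_addr.
  by rewrite lerDl sumr_ge0// => i _; rewrite ltW// wt_gt0.
rewrite -[leRHS]mul1r ler_pdivlMr ?subr_gt0//.
have := le_trans SS S2; rewrite -/(S N); lra.
Qed.

Lemma cvg_wt_bounded (b : nat -> nat) a (B : R) :
  (forall N, \sum_(0 <= k < N) (b k.+1)%:R * wt a k.+1 <= B) -> cvg_wt b a.
Proof.
move=> bB; apply: nondecreasing_is_cvgn.
  apply/nondecreasing_seqP => n; rewrite /series /= big_nat_recr//= lerDl.
  by rewrite mulr_ge0 ?ler0n// ltW// wt_gt0.
by exists B => _ [n _ <-]; exact: bB.
Qed.

Lemma cvg_wt_le (b c : nat -> nat) a : (forall m, (0 < m)%N -> (c m <= b m)%N) ->
  cvg_wt b a -> cvg_wt c a.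
Proof.
move=> cb; apply: series_le_cvg => k; rewrite ?mulr_ge0 ?ler0n ?(ltW (wt_gt0 _ _))//.
by rewrite ler_wpM2r ?(ltW (wt_gt0 _ _))// ler_nat cb.
Qed.

Lemma cvg_wt1 a : 1 < a -> cvg_wt (fun=> 1%N) a.
Proof.
move=> a1; apply: (@cvg_wt_bounded _ _ (1 - 2 * wt a 2)^-1) => N.
by under eq_bigr do rewrite mul1r; exact: wtS_bounded.
Qed.

(** The divisor function is the Dirichlet convolution of 1 with itself, so its
    partial sums are at most the squares of those of the series of 1. *)
Lemma cvg_wt_divisors a : 1 < a -> cvg_wt (fun m => size (divisors m)) a.
Proof.
move=> a1; apply: (@cvg_wt_bounded _ _ ((1 - 2 * wt a 2)^-1 ^+ 2)) => N.
apply: (@le_trans _ _ ((\sum_(0 <= k < N) wt a k.+1) ^+ 2)); last first.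
  rewrite lerXn2r ?nnegrE ?wtS_bounded//.
    by rewrite sumr_ge0// => i _; rewrite ltW// wt_gt0.
  by rewrite invr_ge0 subr_ge0 ltW// wt2_lt.
rewrite expr2 big_distrl/= !big_mkord.
under [leRHS]eq_bigr do rewrite big_distrr/=.
apply: (@le_trans _ _ (\sum_(k < N) \sum_(i < N) \sum_(j < N)
    ((i.+1 * j.+1 == k.+1)%N)%:R * wt a k.+1)).
  apply: ler_sum => k _.
  under eq_bigr do rewrite -big_distrl/=.
  rewrite -big_distrl/= ler_wpM2r ?(ltW (wt_gt0 _ _))//.
  under eq_bigr do rewrite -natr_sum.
  rewrite -natr_sum ler_nat.
  apply: (@leq_trans (\sum_(i < N) (i.+1 %| k.+1))).
    apply: (leq_trans (_ : _ <= size [seq i <- iota 1 N | (i %| k.+1)%N])%N).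
      apply: uniq_leq_size (divisors_uniq _) _ => i.
      rewrite -dvdn_divisors// mem_filter => ik; rewrite ik mem_iota add1n ltnS.
      by rewrite (dvdn_gt0 _ ik)//= (leq_trans (dvdn_leq _ ik)).
    rewrite size_filter -sum1_count big_mkcond/=.
    rewrite (_ : iota 1 N = index_iota 1 N.+1); last by rewrite /index_iota subn1.
    rewrite big_add1 big_mkord.
    by apply: leq_sum => i _; case: ifP.
  apply: leq_sum => i _; case: (boolP (i.+1 %| k.+1)%N) => // /dvdnP[j e].
  case: j e => [|j] e; first by rewrite mul0n in e.
  have jN : (j < N)%N.
    by apply: leq_trans (ltn_ord k); rewrite e leq_pmulr.
  by rewrite (bigD1 (Ordinal jN))//= [in X in (X + _)%N]mulnC e eqxx.
rewrite exchange_big/=; apply: ler_sum => i _.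
rewrite exchange_big/=; apply: ler_sum => j _.
rewrite -wtM//.
have [ijN|ijN] := ltnP (i.+1 * j.+1).-1 N; last first.
  rewrite big1 ?(ltW (wt_gt0 _ _))// => k _.
  case: eqP => [e|]; rewrite ?mul0r//.
  by move: ijN; rewrite e /= leqNgt ltn_ord.
rewrite (bigD1 (Ordinal ijN))//= mulSn addSn eqxx mul1r big1 ?addr0// => k nk.
case: eqP => [e|_]; last by rewrite mul0r.
by case/eqP: nk; apply: ord_inj => /=; move: e => /=; lia.
Qed.

Lemma cexpD z z' : cexp (z + z') = cexp z * cexp z'.
Proof.
case: z z' => a b [c e]; rewrite /cexp /= expRD cosD sinD.
by apply/eqP; rewrite eq_complex /=; apply/andP; split; apply/eqP; ring.
Qed.

Lemma norm_cexp z : `|cexp z| = (expR (Re z))%:C%C.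
Proof.
rewrite /cexp normrM !normc_def /= expr0n addr0 sqrtr_sqr cos2Dsin2 sqrtr1.
by rewrite mulr1 ger0_norm// expR_ge0.
Qed.

Lemma cpowM s j k : (0 < j)%N -> (0 < k)%N -> cpow (j * k) s = cpow j s * cpow k s.
Proof.
move=> j0 k0; rewrite /cpow -cexpD -mulrDr -rmorphD /= natrM lnM ?posrE ?ltr0n//.
Qed.

Lemma cpow1 s : cpow 1 s = 1.
Proof.
rewrite /cpow ln1 mulr0 /cexp /= expR0 cos0 sin0.
by apply/eqP; rewrite eq_complex /= !(mulr1,mulr0,subr0,addr0) !eqxx.
Qed.

Lemma cpow_double k s : cpow k (- (2 * s)) = cpow k (- s) ^+ 2.
Proof. by rewrite expr2 /cpow -cexpD; congr cexp; ring. Qed.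

Lemma norm_cpow k s : `|cpow k (- s)| = (wt (Re s) k)%:C%C.
Proof.
rewrite /cpow norm_cexp /wt; congr (expR _)%:C%C.
by case: s => a b /=; rewrite mulr0 subr0.
Qed.

Lemma wt_lt1 a k : 0 < a -> (1 < k)%N -> wt a k < 1.
Proof.
move=> a0 k1; rewrite /wt -[ltRHS]expR0 ltr_expR mulNr oppr_lt0 mulr_gt0// ln_gt0//.
by rewrite ltr1n.
Qed.

Lemma cvg_dirichlet (b : nat -> nat) s : cvg_wt b (Re s) ->
  cvgn (dirichlet_series b s).
Proof.
move=> bs.
have cvgp (p : {additive C -> R}) : (forall z, `|p z| %:C%C <= `|z|) ->
    cvgn (fun n => p (dirichlet_series b s n)).
  move=> pz; have -> : (fun n => p (dirichlet_series b s n)) =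
      series (fun k => p ((b k.+1)%:R * cpow k.+1 (- s))).
    by apply/funext => n; rewrite /dirichlet_series /series /= raddf_sum.
  apply: normed_cvg; apply: series_le_cvg bs => k.
  - exact: normr_ge0.
  - by rewrite mulr_ge0 ?ler0n// ltW// wt_gt0.
  rewrite -lecR; apply: le_trans (pz _) _.
  by rewrite normrM norm_cpow normr_nat rmorphM rmorph_nat.
have /cvg_ex[x cx] := cvgp _ (@normc_ge_Re R).
have /cvg_ex[y cy] : cvgn (fun n => Im (dirichlet_series b s n)).
  by apply: cvgp => z; rewrite -normrN -ReiNIm (le_trans (normc_ge_Re _))// normrM normi mulr1.
by apply/cvg_ex; exists (x +i* y)%C; apply: cvgC_ReIm.
Qed.

End ComplexSeries.

(** * Sieving a Dirichlet series *)
Section Sieve.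
Variable R : realType.
Local Notation C := R[i].
Implicit Types (u : nat -> C) (s z l : C).
Import complex.

Lemma cvgC_norm_le u l (e : R) : u @ \oo --> l ->
  (\forall n \near \oo, `|u n| <= e%:C%C) -> `|l| <= e%:C%C.
Proof.
move=> /cvgrPdist_lt ul ue.
have [x lx] : exists x : R, `|l| = x%:C%C by rewrite normc_def; eexists.
rewrite lx lecR leNgt; apply/negP => ex.
have := ul (x - e)%:C%C; rewrite ltcR subr_gt0 => /(_ ex) {}ul.
near \oo => n.
have : `|l| < (x - e)%:C%C + e%:C%C.
  rewrite -[X in `|X|](subrK (u n)) (le_lt_trans (ler_normD _ _))//.
  by apply: ltr_leD; near: n.
by rewrite lx -rmorphD /= subrK ltxx.
Unshelve. all: by end_near. Qed.

Lemma cvgC_scale (c : C) u l : u @ \oo --> l -> (fun n => c * u n) @ \oo --> c * l.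
Proof. by move=> ul; exact: (@cvgM _ _ \oo _ _ _ _ _ (cvg_cst c) ul). Qed.

Lemma cvgC_add u v l l' : u @ \oo --> l -> v @ \oo --> l' ->
  (fun n => u n + v n) @ \oo --> l + l'.
Proof. by move=> ul vl; exact: (@cvgD _ _ _ \oo _ u v l l' ul vl). Qed.

Lemma cvgC_sub u v l l' : u @ \oo --> l -> v @ \oo --> l' ->
  (fun n => u n - v n) @ \oo --> l - l'.
Proof. by move=> ul vl; exact: (@cvgB _ _ _ \oo _ u v l l' ul vl). Qed.

Lemma cvgC_mul u v l l' : u @ \oo --> l -> v @ \oo --> l' ->
  (fun n => u n * v n) @ \oo --> l * l'.
Proof. by move=> ul vl; exact: (@cvgM _ _ \oo _ u v l l' ul vl). Qed.

Lemma cvgC_inv u l : l != 0 -> u @ \oo --> l -> (fun n => (u n)^-1) @ \oo --> l^-1.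
Proof. by move=> l0 ul; exact: (@cvgV _ _ \oo _ u l l0 ul). Qed.

Lemma cvg_divn u l q : (0 < q)%N -> u @ \oo --> l -> (fun N => u (N %/ q)%N) @ \oo --> l.
Proof.
move=> q0 ul; apply: cvg_comp ul.
move=> A [m _ mA]; exists (m * q)%N => // N /= mN; apply: mA => /=.
by rewrite leq_divRL.
Qed.

(** Multiplication of a Dirichlet series by q ^ (-s), read on its coefficients. *)
Definition coef_shift q (a : nat -> nat) m := if (q %| m)%N then a (m %/ q)%N else 0%N.

Lemma dirichlet_coef_shift q a s N : (0 < q)%N ->
  dirichlet_series (coef_shift q a) s N = cpow q (- s) * dirichlet_series a s (N %/ q)%N.
Proof.
move=> q0; rewrite /dirichlet_series /series /=.
elim: N => [|N IH]; first by rewrite div0n !big_nil mulr0.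
rewrite big_nat_recr//= IH divnS// /coef_shift; case: ifPn => [/dvdnP[k e]|_] /=; last first.
  by rewrite mul0r addr0 add0n.
rewrite add1n big_nat_recr//= mulrDr; congr (_ + _).
have -> : (N %/ q).+1 = k.
  by rewrite -[RHS](mulnK _ q0) -e divnS// e dvdn_mull.
rewrite e mulnK// cpowM//; last by case: k e.
by rewrite mulrA mulrC.
Qed.

(** Multiplication of a Dirichlet series by a trinomial such as an Euler factor
    (1 - X) (1 - chi X), with X = p ^ (-s), q = p and r = p ^ 2. *)
Lemma dirichlet_recurrence (a b : nat -> nat) (u v : int) q r s l :
  (0 < q)%N -> (0 < r)%N ->
  (forall m, (0 < m)%N -> (b m)%:Z = (a m)%:Z - u * (coef_shift q a m)%:Z + v * (coef_shift r a m)%:Z) ->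
  dirichlet_series a s @ \oo --> l ->
  dirichlet_series b s @ \oo --> (1 - u%:~R * cpow q (- s) + v%:~R * cpow r (- s)) * l.
Proof.
move=> q0 r0 bE al.
have -> : dirichlet_series b s = fun N => dirichlet_series a s N
    + (- u%:~R * (cpow q (- s) * dirichlet_series a s (N %/ q)%N)
    + v%:~R * (cpow r (- s) * dirichlet_series a s (N %/ r)%N)).
  apply/funext => N; rewrite -!dirichlet_coef_shift// /dirichlet_series /series /=.
  rewrite !mulr_sumr -!big_split/=; apply: eq_bigr => k _.
  have <- : (b k.+1)%:~R = (b k.+1)%:R :> C by [].
  by rewrite bE// !(rmorphD, rmorphN, rmorphM)/= !mulrDl !mulNr !mulrA addrA.
have -> : (1 - u%:~R * cpow q (- s) + v%:~R * cpow r (- s)) * l =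
    l + (- u%:~R * (cpow q (- s) * l) + v%:~R * (cpow r (- s) * l)) by ring.
have qr (c : C) k : (0 < k)%N -> (fun N => c * (cpow k (- s) * dirichlet_series a s (N %/ k)%N))
    @ \oo --> c * (cpow k (- s) * l).
  move=> k0.
  exact (cvgC_scale (cvgC_scale (cvg_divn k0 al))).
exact (cvgC_add al (cvgC_add (qr (- u%:~R) _ q0) (qr v%:~R _ r0))).
Qed.

(** The series differ only by terms of index at least n, where both coefficients
    lie between 0 and b: the distance is at most a tail of the series of b. The
    partial sum at n.-1 collects the coefficients of index 1 to n - 1. *)
Lemma dirichlet_dist (a a' b : nat -> nat) s l l' n : cvg_wt b (Re s) ->
  (forall m, (0 < m)%N -> (a m <= b m)%N) ->
  (forall m, (0 < m)%N -> (a' m <= b m)%N) ->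
  (forall m, (0 < m < n)%N -> a m = a' m) ->
  dirichlet_series a s @ \oo --> l -> dirichlet_series a' s @ \oo --> l' ->
  let B := series (fun k => (b k.+1)%:R * wt (Re s) k.+1) in
  `|l - l'| <= (limn B - B n.-1)%:C%C.
Proof.
move=> bs ab a'b aa' al a'l /=; set B := series _.
apply: (cvgC_norm_le (cvgC_sub al a'l)); exists n.-1 => // N /= nN.
have Bnd : {homo B : x y / (x <= y)%N >-> x <= y}.
  apply/nondecreasing_seqP => k; rewrite /B /series /= big_nat_recr//= lerDl.
  by rewrite mulr_ge0 ?ler0n// ltW// wt_gt0.
apply: (@le_trans _ _ (B N - B n.-1)%:C%C); last first.
  by rewrite lecR lerD2r; apply: nondecreasing_cvgn_le.
rewrite /B /dirichlet_series sub_series_geq//.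
rewrite /series/= -sumrB (@big_cat_nat _ _ _ n.-1)//= big1_seq ?add0r; last first.
  move=> k; rewrite mem_index_iota => /= kn.
  by rewrite aa' ?subrr//; lia.
rewrite rmorph_sum/=; apply: le_trans (ler_norm_sum _ _ _) _; apply: ler_sum => k _.
rewrite -mulrBl normrM norm_cpow rmorphM/= ler_wpM2r ?ler0c ?(ltW (wt_gt0 _ _))//.
have am : (a k.+1 <= b k.+1)%N by exact: ab.
have am' : (a' k.+1 <= b k.+1)%N by exact: a'b.
rewrite rmorph_nat; case: (leqP (a' k.+1) (a k.+1)) => [|/ltnW] h; last rewrite distrC.
  by rewrite -natrB// normr_nat ler_nat (leq_trans (leq_subr _ _)).
by rewrite -natrB// normr_nat ler_nat (leq_trans (leq_subr _ _)).
Qed.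

(** The scheme of all the product formulas below: a n is what sieving by the
    primes below n leaves of a 0, one step of the sieve multiplies the sum by
    c n, and below n nothing more will be removed, so that [dirichlet_dist]
    controls the distance to the limit. *)
Lemma sieve_limit (a : nat -> nat -> nat) (a' b : nat -> nat) (c : nat -> C) s :
  cvg_wt b (Re s) ->
  (forall n m, (0 < m)%N -> (a n m <= b m)%N) ->
  (forall n m, (0 < m < n)%N -> a n m = a' m) ->
  (forall n l, dirichlet_series (a n) s @ \oo --> l ->
     dirichlet_series (a n.+1) s @ \oo --> c n * l) ->
  (fun n => \prod_(0 <= i < n) c i * dirichlet_sum (a 0%N) s) @ \oo
    --> dirichlet_sum a' s.
Proof.
move=> bs ab aa' ac.
have a0 : dirichlet_series (a 0%N) s @ \oo --> dirichlet_sum (a 0%N) s.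
  by apply: cvg_dirichlet; apply: cvg_wt_le bs; exact: ab.
have an n : dirichlet_series (a n) s @ \oo -->
    \prod_(0 <= i < n) c i * dirichlet_sum (a 0%N) s.
  elim: n => [|n IH]; first by rewrite big_nil mul1r.
  rewrite big_nat_recr; last by [].
  rewrite /= [X in X * _]mulrC -mulrA; exact (ac _ _ IH).
have a'b m : (0 < m)%N -> (a' m <= b m)%N.
  by move=> m0; rewrite -(aa' m.+1) ?ab// m0 ltnSn.
have a'l : dirichlet_series a' s @ \oo --> dirichlet_sum a' s.
  by apply: cvg_dirichlet; apply: cvg_wt_le bs.
pose B := series (fun k => (b k.+1)%:R * wt (Re s) k.+1).
apply/cvgrPdist_lt => e /gtC0[r r0 ->].
have /cvgrPdist_lt/(_ _ r0) := bs; rewrite -/B => -[M _ MB].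
exists M.+1 => // -[|n]//=; rewrite ltnS => Mn; rewrite distrC.
apply: le_lt_trans (dirichlet_dist bs (ab n.+1) a'b (aa' n.+1) (an n.+1) a'l) _.
by rewrite ltcR; apply: le_lt_trans (MB _ Mn); rewrite ler_norm.
Qed.

End Sieve.

(** * Euler products over a set of primes *)
Section EulerProducts.
Variable R : realType.
Local Notation C := R[i].
Implicit Types (u : nat -> C) (s z l : C) (P : pred nat).
Import complex.

Lemma eq_dirichlet (a b : nat -> nat) s : (forall m, (0 < m)%N -> a m = b m) ->
  dirichlet_series a s = dirichlet_series b s.
Proof.
by move=> ab; rewrite /dirichlet_series; congr series; apply/funext => k; rewrite ab.
Qed.

Lemma cvg_eq_dirichlet (a b : nat -> nat) s l : (forall m, (0 < m)%N -> b m = a m) ->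
  dirichlet_series a s @ \oo --> l -> dirichlet_series b s @ \oo --> 1 * l.
Proof. by move=> ab; rewrite mul1r (eq_dirichlet s ab). Qed.

Lemma eq_dirichlet_sum (a b : nat -> nat) s : (forall m, (0 < m)%N -> a m = b m) ->
  dirichlet_sum a s = dirichlet_sum b s.
Proof. by move=> ab; rewrite /dirichlet_sum (eq_dirichlet _ ab). Qed.

Lemma dirichlet_sum_unit s : dirichlet_sum (fun m => m == 1%N) s = 1.
Proof.
apply/cvg_lim => //; apply: cvg_near_cst; exists 1%N => // -[|N] //= _.
rewrite /dirichlet_series /series /= big_nat_recl//= big1 ?addr0 ?mul1r ?cpow1//.
by move=> k _; rewrite mul0r.
Qed.

Lemma cpow_neq1 s p : 0 < Re s -> prime p -> 1 - cpow p (- s) != 0.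
Proof.
move=> s0 pp; rewrite subr_eq0; apply/eqP => e.
have := norm_cpow p s; rewrite -e normr1 => /esym/eqP; rewrite -(rmorph1 (real_complex R)).
by rewrite (inj_eq (@complexI _)) lt_eqF// wt_lt1// prime_gt1.
Qed.

(** Among the integers composed of primes of P, those that a sieve by the primes
    below n leaves. *)
Definition rough_in P n m : bool := all (fun p => P p && (n <= p)%N) (primes m).

Lemma rough_in0 m : rough_in xpredT 0 m.
Proof. by apply/allP. Qed.

Lemma rough_in_small P n m : (0 < m < n)%N -> rough_in P n m = (m == 1%N).
Proof.
move=> /andP[m0 mn]; have [->//|m1] := eqVneq m 1%N.
apply/negbTE/allPn; exists (pdiv m).
  by rewrite mem_primes pdiv_prime ?m0 ?pdiv_dvd// ltn_neqAle eq_sym m1.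
by rewrite negb_and -ltnNge (leq_ltn_trans (pdiv_leq m0))// orbT.
Qed.

Lemma rough_inS P n m : (0 < m)%N -> rough_in P n.+1 m =
  rough_in P n m && ~~ [&& prime n, P n & n %| m]%N.
Proof.
move=> m0; apply/idP/andP => [/allP h|[/allP h nm]].
  split; first by apply/allP => q /h/andP[-> /ltnW ->].
  apply/negP => /and3P[pn _ nm].
  have : n \in primes m by rewrite mem_primes pn m0.
  by move=> /h; rewrite ltnn andbF.
apply/allP => q qm; have /andP[Pq nq] := h _ qm; rewrite Pq /= ltn_neqAle nq andbT.
apply: contra nm => /eqP ->; rewrite Pq /=.
by move: qm; rewrite mem_primes => /and3P[-> _ ->].
Qed.

Lemma rough_in_prime P p k : prime p -> (0 < k)%N -> P p ->
  rough_in P p (p * k) = rough_in P p k.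
Proof.
move=> pp k0 Pp; rewrite /rough_in.
have /eq_all_r -> : primes (p * k) =i p :: primes k.
  by move=> q; rewrite primesM ?(prime_gt0 pp)// primes_prime// inE.
by rewrite /= Pp leqnn.
Qed.

(** Sieving the integers composed of primes of P: the step at p multiplies the
    sum by 1 - p ^ (-s), and only the term of index 1 survives. As what survives
    is not 0, neither is the initial sum L. *)
Lemma euler_product_cvg P s : 1 < Re s ->
  exists2 L : C, L = dirichlet_sum (rough_in P 0) s /\ L != 0 &
    euler_product P (fun p => (1 - cpow p (- s))^-1) @ \oo --> L.
Proof.
move=> s1; have s0 : 0 < Re s by exact: lt_trans ltr01 s1.
pose c p := if prime p && P p then 1 - cpow p (- s) else 1.
have cc : (fun n => \prod_(0 <= i < n) c i * dirichlet_sum (rough_in P 0) s) @ \oo --> (1 : C).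
  rewrite -[X in _ --> X](dirichlet_sum_unit s).
  apply: (@sieve_limit _ (fun n m => rough_in P n m) _ (fun=> 1%N)).
  - exact: cvg_wt1.
  - by move=> n m _; exact: leq_b1.
  - by move=> n m mn; rewrite rough_in_small.
  - move=> n l; rewrite /c; case: ifPn => [/andP[pn Pn]|npP].
      have n0 := prime_gt0 pn.
      rewrite (_ : 1 - _ = 1 - 1%:~R * cpow n (- s) + 0%:~R * cpow 1 (- s)); last first.
        by rewrite mul1r mul0r addr0.
      apply: dirichlet_recurrence => [||m m0].
      - by [].
      - by [].
      rewrite mul1r mul0r addr0 rough_inS// pn Pn /= /coef_shift.
      case: ifPn => [/dvdnP[k e]|_]; last by rewrite andbT subr0.
      have k0 : (0 < k)%N by case: k e m0 => // ->.
      by rewrite e mulnK// mulnC rough_in_prime// andbF subrr.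
    apply: cvg_eq_dirichlet => m m0.
    rewrite rough_inS//; case: (boolP [&& _, _ & _]); last by rewrite andbT.
    by move=> /and3P[pn Pn _]; rewrite pn Pn in npP.
set L := dirichlet_sum _ s in cc *.
have L0 : L != 0.
  apply/negP => /eqP L0; move: cc; rewrite L0.
  under eq_fun do rewrite mulr0.
  move=> /(cvg_unique (@norm_hausdorff _ C^o)) /(_ (cvg_cst 0)) /eqP.
  by rewrite oner_eq0.
exists L; first by split.
have -> : euler_product P (fun p => (1 - cpow p (- s))^-1) =
    fun n => L * (\prod_(0 <= i < n) c i * L)^-1.
  apply/funext => n; rewrite invfM mulrCA divff// mulr1 -prodfV /euler_product big_mkcond/=.
  by apply: eq_bigr => i _; rewrite /c; case: ifP => // _; rewrite invr1.
have := @cvgC_scale _ L _ _ (cvgC_inv (oner_neq0 _) cc).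
by rewrite invr1 mulr1.
Qed.

Lemma zeta_rough s : zeta s = dirichlet_sum (rough_in xpredT 0) s.
Proof.
by apply: eq_dirichlet_sum => m _; rewrite rough_in0.
Qed.

End EulerProducts.

(** * Coefficients satisfying a Hecke recurrence *)
Section Hecke.
Variable R : realType.
Local Notation C := R[i].
Import complex.
Variables (chi : nat -> int) (f : nat -> nat).
Hypothesis chi1 : forall p, prime p -> `|chi p| <= 1.
Hypothesis f1 : f 1%N = 1%N.
Hypothesis hecke : forall p m, prime p -> (0 < m)%N ->
  (f (p * m))%:Z = (1 + chi p) * (f m)%:Z - chi p * (coef_shift p f m)%:Z.

(** By the recurrence, the increment f(p^(k+1) m) - f(p^k m) is multiplied by
    chi p when k increases by 1. *)
Lemma hecke_prime_power p k m : prime p -> (0 < m)%N -> ~~ (p %| m)%N ->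
  `|(f (p ^ k.+1 * m))%:Z - (f (p ^ k * m))%:Z| <= (f m)%:Z.
Proof.
move=> pp m0 pm; have p0 := prime_gt0 pp.
elim: k => [|k IH].
  rewrite expn1 expn0 mul1n hecke// /coef_shift (negbTE pm) mulr0 subr0.
  rewrite mulrDl mul1r addrC addKr normrM [X in _ * X]ger0_norm//.
  by rewrite -[leRHS]mul1r ler_wpM2r// chi1.
have E : (p ^ k.+1 * m = p * (p ^ k * m))%N by rewrite expnS mulnA.
rewrite expnS -mulnA hecke ?muln_gt0 ?expn_gt0 ?p0// /coef_shift.
rewrite E in IH *; rewrite dvdn_mulr// mulKn//.
rewrite (_ : _ - _ = chi p * ((f (p * (p ^ k * m)))%:Z - (f (p ^ k * m))%:Z)); last by ring.
by rewrite normrM (le_trans _ IH)// -[leRHS]mul1r ler_wpM2r// chi1.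
Qed.

(** The products p^i e with i <= k and e dividing m are distinct. *)
Lemma size_divisors_prime_power p k m : prime p -> (0 < m)%N -> ~~ (p %| m)%N ->
  (k.+1 * size (divisors m) <= size (divisors (p ^ k * m)))%N.
Proof.
move=> pp m0 pm; have p0 := prime_gt0 pp.
pose s := [seq (p ^ i * e)%N | i <- iota 0 k.+1, e <- divisors m].
have <- : size s = (k.+1 * size (divisors m))%N by rewrite size_allpairs size_iota.
apply: uniq_leq_size.
  apply: allpairs_uniq; rewrite ?iota_uniq ?divisors_uniq// => -[i e] [j e'].
  move=> /allpairsPdep[i1 [e1 [_ He [-> ->]]]] /allpairsPdep[j1 [e2 [_ He' [-> ->]]]].
  have cop x : x \in divisors m -> coprime x p.
    rewrite -dvdn_divisors// => xm; rewrite coprime_sym prime_coprime//.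
    by apply: contra pm => /dvdn_trans; apply.
  have lp x n : x \in divisors m -> logn p (p ^ n * x) = n.
    move=> xm; have x0 : (0 < x)%N by rewrite (dvdn_gt0 m0)// dvdn_divisors.
    by rewrite lognM ?expn_gt0 ?p0// pfactorK// logn_coprime ?addn0// coprime_sym cop.
  rewrite /uncurry => {}e; have ij : i1 = j1 by rewrite -(lp e1 i1 He) e lp.
  by move: e; rewrite ij => /eqP; rewrite eqn_pmul2l ?expn_gt0 ?p0// => /eqP ->.
move=> x /allpairsPdep[i [e [ik em ->]]].
rewrite -dvdn_divisors ?muln_gt0 ?expn_gt0 ?p0// dvdn_mul//.
  by rewrite dvdn_exp2l//; move: ik; rewrite mem_iota add0n ltnS.
by rewrite dvdn_divisors.
Qed.

Lemma hecke_le_divisors m : (0 < m)%N -> (f m <= size (divisors m))%N.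
Proof.
elim/ltn_ind: m => m IH m0.
have [->|m1] := eqVneq m 1%N; first by rewrite f1.
have m_gt1 : (1 < m)%N by rewrite ltn_neqAle eq_sym m1.
have pp := pdiv_prime m_gt1; set p := pdiv m in pp.
have [k cop mE] := pfactor_coprime pp m0.
set e := logn p m in mE.
have k0 : (0 < k)%N by move: m0; rewrite mE muln_gt0 => /andP[].
have pk : ~~ (p %| k)%N by rewrite -prime_coprime.
have e0 : (0 < e)%N by rewrite logn_gt0 mem_primes pp m0 pdiv_dvd.
have km : (k < m)%N by rewrite mE -[ltnLHS]muln1 ltn_pmul2l// -(expn0 p) ltn_exp2l// prime_gt1.
have step n : (f (p ^ n * k) <= n.+1 * f k)%N.
  elim: n => [|n IHn]; first by rewrite expn0 !mul1n.
  have := hecke_prime_power n pp k0 pk; lia.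
rewrite mE mulnC (leq_trans (step e))// (leq_trans _ (size_divisors_prime_power _ _ _ _))//.
by rewrite leq_mul2l IH// orbT.
Qed.

Lemma cvg_wt_hecke a : 1 < a -> @cvg_wt R f a.
Proof. by move=> a1; apply: cvg_wt_le (cvg_wt_divisors a1); exact: hecke_le_divisors. Qed.

(** At a multiple p k of p, the right-hand side is the indicator of k times
    the difference of the two members of the recurrence at k. *)
Lemma hecke_rough_step p m : prime p -> (0 < m)%N ->
  ((rough_in xpredT p.+1 m * f m)%N)%:Z =
  ((rough_in xpredT p m * f m)%N)%:Z
  - (1 + chi p) * (coef_shift p (fun m => rough_in xpredT p m * f m)%N m)%:Z
  + chi p * (coef_shift (p ^ 2) (fun m => rough_in xpredT p m * f m)%N m)%:Z.
Proof.
move=> pp m0; have p0 := prime_gt0 pp.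
rewrite rough_inS// pp /= /coef_shift; case: ifPn => [/dvdnP[k e]|pm]; last first.
  rewrite ifN ?mulr0 ?subr0 ?addr0 ?andbT//.
  by apply: contra pm; apply: dvdn_trans; rewrite expnS dvdn_mulr.
have k0 : (0 < k)%N by case: k e m0 => // ->.
rewrite andbF mul0n e mulnK// [(k * p)%N]mulnC rough_in_prime//.
have -> : (p ^ 2 %| p * k)%N = (p %| k)%N by rewrite expnS expn1 dvdn_pmul2l.
rewrite !PoszM hecke// /coef_shift; case: ifPn => [/dvdnP[j kE]|_]; last by ring.
have j0 : (0 < j)%N by case: j kE k0 => // ->.
rewrite kE mulnK// (_ : p * (j * p) = j * p ^ 2)%N; last by rewrite mulnCA expnS expn1.
rewrite mulnK ?expn_gt0 ?p0// [(j * p)%N]mulnC rough_in_prime//.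
by rewrite !PoszM; ring.
Qed.
 
(** The partial product times the sum is the sum of the terms whose index has no
    prime factor below n. *)
Lemma hecke_euler (s : C) : 1 < Re s ->
  (fun n => \prod_(0 <= p < n | prime p)
     ((1 - cpow p (- s)) * (1 - (chi p)%:~R * cpow p (- s))) * dirichlet_sum f s)
  @ \oo --> (1 : C).
Proof.
move=> s1; rewrite -[X in _ --> X](dirichlet_sum_unit s).
under eq_fun do rewrite big_mkcond/=.
have -> : dirichlet_sum f s = dirichlet_sum (fun m => rough_in xpredT 0 m * f m)%N s.
  by apply: eq_dirichlet_sum => m _; rewrite rough_in0 mul1n.
apply: (@sieve_limit _ (fun n m => rough_in xpredT n m * f m)%N _ f).
- exact: cvg_wt_hecke.
- by move=> n m _; case: rough_in; rewrite ?mul1n ?mul0n.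
- move=> n m mn; rewrite rough_in_small//.
  by case: eqP => [->|_]; rewrite ?f1 ?mul0n.
- move=> n l; case: ifPn => [pn|npn].
    have n0 := prime_gt0 pn.
    rewrite (_ : _ * (1 - _) = 1 - (1 + chi n)%:~R * cpow n (- s)
        + (chi n)%:~R * cpow (n ^ 2) (- s)); last first.
      by rewrite expnS expn1 cpowM// rmorphD/=; ring.
    apply: dirichlet_recurrence; rewrite ?expn_gt0 ?n0//.
    by move=> m m0; exact: hecke_rough_step.
  apply: cvg_eq_dirichlet => m m0.
  by rewrite rough_inS// (negbTE npn) andbT.
Qed.

(** Here fpr n m is the number of ideals of norm m that are divisible by no prime
    below n. Those of them that p divides are p times the ideals counted by
    fpr p (m / p^2); removing them multiplies the series by 1 - p^(-2 s), and the
    product of these factors is 1 / zeta (2 s). *)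
Lemma hecke_primitive (fpr : nat -> nat -> nat) (f' : nat -> nat) (s : C) : 1 < Re s ->
  (forall m, (0 < m)%N -> fpr 0%N m = f m) ->
  (forall n m, (0 < m)%N -> (fpr n m <= f m)%N) ->
  (forall n m, (0 < m < n)%N -> fpr n m = f' m) ->
  (forall n m, (0 < m)%N -> ~~ prime n -> fpr n.+1 m = fpr n m) ->
  (forall p m, (0 < m)%N -> prime p ->
     (fpr p.+1 m + coef_shift (p ^ 2) (fpr p) m = fpr p m)%N) ->
  [/\ cvgn (dirichlet_series f' s), zeta (2 * s) != 0
    & dirichlet_sum f' s = dirichlet_sum f s / zeta (2 * s)].
Proof.
move=> s1 fpr0 fle fprE fnp fp.
have f'le m : (0 < m)%N -> (f' m <= f m)%N.
  by move=> m0; rewrite -(fprE m.+1) ?fle// m0 ltnSn.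
have s2 : 1 < Re (2 * s).
  by rewrite mulr_natl mulr2n raddfD /=; lra.
have [L [LE L0] cL] := euler_product_cvg xpredT s2.
rewrite zeta_rough -LE; split; [|exact: L0|].
  by apply: cvg_dirichlet; apply: cvg_wt_le f'le (cvg_wt_hecke s1).
have c1 : (fun n => \prod_(0 <= p < n | prime p) (1 - cpow p (- (2 * s))) * dirichlet_sum f s)
    @ \oo --> dirichlet_sum f' s.
  under eq_fun do rewrite big_mkcond/=.
  rewrite -(eq_dirichlet_sum _ fpr0); apply: (@sieve_limit _ fpr _ f).
  - exact: cvg_wt_hecke.
  - exact: fle.
  - exact: fprE.
  move=> n l; case: ifPn => [pn|npn]; last first.
    by apply: cvg_eq_dirichlet => m m0; rewrite fnp.
  have n0 := prime_gt0 pn.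
  rewrite (_ : 1 - _ = 1 - 1%:~R * cpow (n ^ 2) (- s) + 0%:~R * cpow 1 (- s)); last first.
    by rewrite mul1r mul0r addr0 cpow_double expnS expn1 cpowM// expr2.
  apply: dirichlet_recurrence; rewrite ?expn_gt0 ?n0// => m m0.
  by rewrite mul1r mul0r addr0 -(fp n m)// PoszD addrK.
have c2 : (fun n => \prod_(0 <= p < n | prime p) (1 - cpow p (- (2 * s))) * dirichlet_sum f s)
    @ \oo --> dirichlet_sum f s / L.
  under eq_fun do rewrite mulrC; apply: cvgC_scale.
  have -> : (fun n => \prod_(0 <= p < n | prime p) (1 - cpow p (- (2 * s)))) =
      fun n => (euler_product xpredT (fun p => (1 - cpow p (- (2 * s)))^-1) n)^-1.
    apply/funext => n; rewrite /euler_product prodfV invrK.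
    by apply: eq_bigl => p; rewrite andbT.
  by apply: cvgC_inv cL; exact: L0.
exact: (cvg_unique (@norm_hausdorff _ C^o) c1 c2).
Qed.

End Hecke.

(** * Indices of sublattices *)
Section Index.
Variable R : realType.
Local Notation C := R[i].
Implicit Types (G L M : set C) (a z : C).

Lemma subgroupB G x y : additive_subgroup G -> G x -> G y -> G (x - y).
Proof. by case=> _; apply. Qed.

Lemma subgroupN G x : additive_subgroup G -> G x -> G (- x).
Proof. by move=> gG Gx; rewrite -sub0r; apply: subgroupB => //; case: gG. Qed.

Lemma subgroupD G x y : additive_subgroup G -> G x -> G y -> G (x + y).
Proof. by move=> gG Gx Gy; rewrite -[y]opprK; apply: subgroupB => //; apply: subgroupN. Qed.

Lemma eq_coset L x y : additive_subgroup L ->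
  [set x + z | z in L] = [set y + z | z in L] <-> L (x - y).
Proof.
move=> gL; split => [e|Lxy].
  have : [set x + z | z in L] x by exists 0; [case: gL|rewrite addr0].
  by rewrite e => -[z Lz <-]; rewrite addrC addKr.
apply/seteqP; split => _ [z Lz <-].
  by exists (x - y + z); [exact: subgroupD|ring].
by exists (z - (x - y)); [exact: subgroupB|ring].
Qed.

(** Numbering the cosets by a function on elements makes it possible to compute
    with indices without handling sets of cosets. *)
Definition numbers_cosets G L m (phi : C -> nat) :=
  [/\ forall x, G x -> (phi x < m)%N,
      forall k, (k < m)%N -> exists2 x, G x & phi x = k
    & forall x y, G x -> G y -> phi x = phi y <-> L (x - y)].

Lemma has_indexP G L m : additive_subgroup L ->
  has_index G L m <-> exists phi, numbers_cosets G L m phi.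
Proof.
move=> gL; split => [/card_set_bijP[f [fun_f inj_f surj_f]]|[phi [phim surj_phi inj_phi]]].
  pose c x := [set x + z | z in L].
  have cG x : G x -> cosets G L (c x) by move=> Gx; exists x.
  exists (fun x => f (c x)); split.
  - by move=> x /cG /fun_f.
  - by move=> k /surj_f[_ [x Gx <-] <-]; exists x.
  - move=> x y Gx Gy; rewrite -(eq_coset _ _ gL); split=> [|e]; last by rewrite /c e.
    by apply: inj_f; apply/mem_set; exact: cG.
have /choice[g gP] : forall k, exists x, (k < m)%N -> G x /\ phi x = k.
  move=> k; case: (ltnP k m) => [km|//]; last by exists 0.
  by have [x Gx phix] := surj_phi _ km; exists x.
rewrite /has_index.
have -> : cosets G L = (fun k => [set g k + z | z in L]) @` `I_m.
  apply/seteqP; split => [_ [x Gx <-]|_ [k km <-]]; last by exists (g k) => //; exact: (gP k km).1.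
  exists (phi x); first exact: phim.
  have [Gg phig] := gP _ (phim _ Gx).
  by apply/(eq_coset _ _ gL)/inj_phi.
apply: inj_card_eq => i j /set_mem im /set_mem jm /(eq_coset _ _ gL).
have [[Gi phii] [Gj phij]] := (gP _ im, gP _ jm).
by move/(inj_phi _ _ Gi Gj); rewrite phii phij.
Qed.

Lemma has_index_unique G L m n : has_index G L m -> has_index G L n -> m = n.
Proof. by move=> Gm Gn; apply/card_eq_II; apply: card_eq_trans Gn; apply: card_esym. Qed.

(** If r represents the coset of x modulo M, then x is determined modulo L by r
    and by the coset of x - r in M modulo L. *)
Lemma has_index_trans G M L m n : additive_subgroup G -> additive_subgroup M ->
  additive_subgroup L -> M `<=` G -> L `<=` M ->
  has_index G M m -> has_index M L n -> has_index G L (m * n).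
Proof.
move=> gG gM gL MG LM /(has_indexP _ _ gM)[f [fm surj_f inj_f]]
  /(has_indexP _ _ gL)[h [hn surj_h inj_h]]; apply/(has_indexP _ _ gL).
have /choice[r rP] : forall k, exists x, (k < m)%N -> G x /\ f x = k.
  move=> k; case: (ltnP k m) => [km|//]; last by exists 0.
  by have [x Gx fx] := surj_f _ km; exists x.
have Mr x : G x -> M (x - r (f x)).
  by move=> Gx; have [Gr fr] := rP _ (fm _ Gx); apply/inj_f.
have lt_h x : G x -> (h (x - r (f x))%R < n)%N by move=> Gx; apply/hn/Mr.
exists (fun x => (f x * n + h (x - r (f x))%R)%N); split.
- move=> x Gx; have := fm _ Gx; have := lt_h _ Gx; nia.
- move=> k kmn; have n0 : (0 < n)%N by case: (n) kmn; rewrite ?muln0.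
  have [x Mx hx] := surj_h _ (ltn_pmod k n0).
  have [Gr fr] : G (r (k %/ n)%N) /\ f (r (k %/ n)%N) = (k %/ n)%N.
    by apply: rP; rewrite ltn_divLR.
  have frx : f (r (k %/ n)%N + x) = (k %/ n)%N.
    rewrite -[RHS]fr; apply/inj_f => //; first by apply: subgroupD => //; exact: MG.
    by rewrite addrC addKr.
  exists (r (k %/ n)%N + x); first by apply: subgroupD => //; exact: MG.
  by rewrite frx [_ + x]addrC addrK hx -divn_eq.
move=> x y Gx Gy; split => [e|Lxy].
  have n0 : (0 < n)%N by apply: leq_ltn_trans (lt_h _ Gx).
  have fxy : f x = f y.
    by have := congr1 (divn^~ n) e; rewrite !divnMDl// !divn_small ?lt_h// !addn0.
  have := congr1 (modn^~ n) e; rewrite !modnMDl !modn_small ?lt_h// fxy.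
  move=> /(inj_h _ _ _ (Mr _ Gy)); rewrite -{1}fxy => /(_ (Mr _ Gx)).
  by rewrite opprB addrA subrK.
have fxy : f x = f y by apply/inj_f => //; exact: LM.
rewrite fxy; congr (_ + _)%N; apply/inj_h; [by rewrite -fxy; exact: Mr|exact: Mr|].
by rewrite opprB addrA subrK.
Qed.

Lemma has_index_image (h h' : C -> C) G L m : cancel h h' -> cancel h' h ->
  (forall x y, h' (x - y) = h' x - h' y) -> (forall x y, h (x - y) = h x - h y) ->
  additive_subgroup L ->
  has_index G L m -> has_index (h @` G) (h @` L) m.
Proof.
move=> hK h'K h'B hB gL.
have ghL : additive_subgroup (h @` L).
  split; first by exists 0; [case: gL|have := hB 0 0; rewrite !subrr].
  by move=> _ _ [x Lx <-] [y Ly <-]; exists (x - y); [exact: subgroupB|exact: hB].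
move=> /(has_indexP _ _ gL)[f [fm surj_f inj_f]]; apply/(has_indexP _ _ ghL).
exists (f \o h'); split => /=.
- by move=> _ [x Gx <-]; rewrite hK fm.
- by move=> k /surj_f[x Gx <-]; exists (h x); [exists x|rewrite hK].
- move=> _ _ [x Gx <-] [y Gy <-]; rewrite !hK inj_f// -hB; split=> [Lxy|[z Lz]].
    by exists (x - y).
  by move=> /(can_inj hK) <-.
Qed.

Lemma dilateM a b G : dilate a (dilate b G) = dilate (a * b) G.
Proof.
apply/seteqP; split => [_ [_ [x Gx <-] <-]|_ [x Gx <-]].
  by exists x; rewrite ?mulrA.
by exists (b * x); [exists x|rewrite mulrA].
Qed.

Lemma dilate1 G : dilate 1 G = G.
Proof.
by apply/seteqP; split => [_ [x Gx <-]|x Gx]; [rewrite mul1r|exists x; rewrite ?mul1r].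
Qed.

Lemma dilate_subset a G L : a != 0 -> dilate a G `<=` dilate a L <-> G `<=` L.
Proof.
move=> a0; split => [GL x Gx|GL _ [x Gx <-]]; last by exists x => //; exact: GL.
by have [|y Ly /(mulfI a0) <-//] := GL (a * x); exists x.
Qed.

Lemma dilate_inj a : a != 0 -> injective (@dilate R a).
Proof.
move=> a0 G L e; apply/seteqP; split; apply/(dilate_subset _ _ a0); rewrite e;
  exact: subset_refl.
Qed.

Lemma dilate_subgroup a G : additive_subgroup G -> additive_subgroup (dilate a G).
Proof.
move=> gG; split; first by exists 0; [case: gG|rewrite mulr0].
by move=> _ _ [x Gx <-] [y Gy <-]; exists (x - y); [exact: subgroupB|rewrite mulrBr].
Qed.

Lemma has_index_dilate a G L m : a != 0 -> additive_subgroup L ->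
  has_index (dilate a G) (dilate a L) m <-> has_index G L m.
Proof.
move=> a0 gL.
have im (c : C) G' L' : c != 0 -> additive_subgroup L' -> has_index G' L' m ->
    has_index (dilate c G') (dilate c L') m.
  move=> c0 gL'; apply: (@has_index_image _ ( *%R c^-1)) => //.
  - exact: mulKf.
  - exact: mulVKf.
  - by move=> x y; rewrite mulrBr.
  - by move=> x y; rewrite mulrBr.
split => [/(im a^-1)|]; last exact: im.
rewrite !dilateM mulVf// !dilate1; apply; first by rewrite invr_eq0.
exact: dilate_subgroup.
Qed.

(** Every coset of M is the sum of M and a coset of L. *)
Lemma has_index_exists G M L m : L `<=` M -> additive_subgroup M -> additive_subgroup L ->
  has_index G L m -> exists n, has_index G M n.
Proof.
move=> LM gM gL GL.
suff : finite_set (cosets G M) by [].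
have finL : finite_set (cosets G L) by exists m.
apply: sub_finite_set (finite_image (fun A => [set x + y | x in A & y in M]) finL).
move=> _ [x Gx <-]; exists [set x + z | z in L]; first by exists x.
apply/seteqP; split => [_ [_ [z Lz <-] [y My <-]]|_ [y My <-]].
  by exists (z + y); rewrite ?addrA//; apply: subgroupD => //; exact: LM.
by exists x; [exists 0; [case: gL|rewrite addr0]|exists y].
Qed.

(** For an infinite S both sides are 0. *)
Lemma num_sets_image (f : set C -> set C) (S : set (set C)) :
  injective f -> num_sets (f @` S) = num_sets S.
Proof.
move=> f_inj; rewrite /num_sets.
have fS : f @` S #= S by apply: inj_card_eq => x y _ _; exact: f_inj.
have [[n Sn]|infS] := pselect (finite_set S).
  by rewrite (card_fset_set Sn) (card_fset_set (card_eq_trans fS Sn)).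
have infS' : ~ finite_set (f @` S).
  by move=> [n fSn]; apply: infS; exists n; apply: card_eq_trans fSn; exact: card_esym.
by rewrite /fset_set; case: pselect => //; case: pselect.
Qed.

Lemma num_setsU (A B : set (set C)) : finite_set A -> finite_set B ->
  (num_sets (A `|` B) + num_sets (A `&` B) = num_sets A + num_sets B)%N.
Proof. by move=> fA fB; rewrite /num_sets fset_setU// fset_setI// cardfsUI. Qed.

Lemma num_sets0 : num_sets (set0 : set (set C)) = 0%N.
Proof. by rewrite /num_sets fset_set0 cardfs0. Qed.

Lemma num_sets1 (A : set C) : num_sets [set A] = 1%N.
Proof. by rewrite /num_sets fset_set1 cardfs1. Qed.

Lemma num_sets_le (A B : set (set C)) : finite_set B -> A `<=` B ->
  (num_sets A <= num_sets B)%N.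
Proof.
move=> fB AB; have fA := sub_finite_set AB fB.
by apply/fsubset_leq_card/fsubsetP => x; rewrite !in_fset_set// => /set_mem xA; apply/mem_set/AB.
Qed.

End Index.

(** * Imaginary quadratic orders *)
Section QuadraticOrder.
Variable R : realType.
Local Notation C := R[i].
Import complex.
Implicit Types (I L : set C) (a b z : C).

Definition quadratic_order (w : C) : set C :=
  [set z | exists x y : int, z = x%:~R + y%:~R * w].

Variables (w : C) (t n : int).
Hypothesis w_trace : w + w^*%C = t%:~R.
Hypothesis w_norm : w * w^*%C = n%:~R.
Hypothesis disc_gt0 : 0 < 4 * n - t ^+ 2.
Local Notation O := (quadratic_order w).

Lemma conjc_int (x : int) : (x%:~R : C)^*%C = x%:~R.
Proof. by rewrite rmorph_int. Qed.

Lemma conj_w : w^*%C = t%:~R - w.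
Proof. by rewrite -w_trace addrC addKr. Qed.

Lemma w_sqr : w * w = t%:~R * w - n%:~R.
Proof. by rewrite -w_trace -w_norm; ring. Qed.

(** The norm of x + y w. *)
Definition qform (x y : int) : int := x ^+ 2 + t * x * y + n * y ^+ 2.

(** Since 4 n - t^2 > 0, the norm form is positive definite. *)
Lemma qform4 x y : 4 * qform x y = (2 * x + t * y) ^+ 2 + (4 * n - t ^+ 2) * y ^+ 2.
Proof. by rewrite /qform; ring. Qed.

Lemma qform_ge0 x y : 0 <= qform x y.
Proof.
have := qform4 x y; have := sqr_ge0 (2 * x + t * y).
have := mulr_ge0 (ltW disc_gt0) (sqr_ge0 y); lia.
Qed.

Lemma qform_eq0 x y : qform x y = 0 -> x = 0 /\ y = 0.
Proof.
move=> q0; have := qform4 x y; rewrite q0 mulr0 => /esym e.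
have h1 := sqr_ge0 (2 * x + t * y); have h2 := mulr_ge0 (ltW disc_gt0) (sqr_ge0 y).
have : (4 * n - t ^+ 2) * y ^+ 2 = 0 by lia.
move/eqP; rewrite mulf_eq0 gt_eqF//= sqrf_eq0 => /eqP y0.
by move: e; rewrite y0 !(mulr0, addr0, expr0n) => /eqP; rewrite sqrf_eq0 => /eqP; lia.
Qed.

Lemma norm_order (x y : int) :
  (x%:~R + y%:~R * w) * (x%:~R + y%:~R * w)^*%C = (qform x y)%:~R.
Proof.
rewrite rmorphD rmorphM/= !conjc_int /qform !(rmorphD, rmorphM, rmorphXn)/=.
by rewrite -w_trace -w_norm; ring.
Qed.

Lemma order_inj (x y x' y' : int) :
  x%:~R + y%:~R * w = x'%:~R + y'%:~R * w -> x = x' /\ y = y'.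
Proof.
move=> e; have : qform (x - x') (y - y') = 0.
  apply/eqP; rewrite -(intr_eq0 C) -norm_order.
  by rewrite !rmorphB /= mulrBl addrACA -opprD e subrr mul0r.
by move=> /qform_eq0[]; lia.
Qed.

Lemma order_int (x : int) : O x%:~R.
Proof. by exists x, 0; rewrite mul0r addr0. Qed.

Lemma order0 : O 0. Proof. exact: (order_int 0). Qed.
Lemma order1 : O 1. Proof. exact: (order_int 1). Qed.
Lemma order_nat (k : nat) : O k%:R. Proof. exact: (order_int k). Qed.
Lemma order_w : O w. Proof. by exists 0, 1; rewrite add0r mul1r. Qed.

Lemma order_subgroup : additive_subgroup O.
Proof.
split; first exact: order0.
move=> _ _ [x [y ->]] [x' [y' ->]]; exists (x - x'), (y - y').
by rewrite !rmorphB /=; ring.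
Qed.

Lemma orderD a b : O a -> O b -> O (a + b).
Proof. exact: subgroupD order_subgroup. Qed.

Lemma orderB a b : O a -> O b -> O (a - b).
Proof. exact: subgroupB order_subgroup. Qed.

Lemma orderM a b : O a -> O b -> O (a * b).
Proof.
move=> [x [y ->]] [x' [y' ->]].
exists (x * x' - n * y * y'), (x * y' + y * x' + t * y * y').
rewrite !(rmorphB, rmorphD, rmorphM)/=; ring: w_sqr.
Qed.

Lemma order_conj a : O a -> O a^*%C.
Proof.
move=> [x [y ->]]; exists (x + t * y), (- y).
by rewrite !(rmorphB, rmorphD, rmorphM, rmorphN)/= !conjc_int conj_w; ring.
Qed.

Lemma order_norm a : O a -> exists k : nat, a * a^*%C = k%:R.
Proof.
move=> [x [y ->]]; exists `|qform x y|%N.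
by rewrite norm_order -[in LHS](gez0_abs (qform_ge0 x y)).
Qed.

Lemma order_conj_im : (@conjc R) @` O = O.
Proof.
apply/seteqP; split => [_ [x Ox <-]|x Ox]; first exact: order_conj.
by exists x^*%C; [exact: order_conj|rewrite conjcK].
Qed.

Lemma dilate_sub a : O a -> dilate a O `<=` O.
Proof. by move=> Oa _ [x Ox <-]; exact: orderM. Qed.

Lemma dilate_mull a b z : dilate a O b -> O z -> dilate a O (z * b).
Proof. by move=> [x Ox <-] Oz; exists (z * x); [exact: orderM|rewrite mulrCA]. Qed.

Lemma dilate_self a : dilate a O a.
Proof. by exists 1; [exact: order1|rewrite mulr1]. Qed.

Lemma dilate_le a b : dilate a O `<=` dilate b O <-> dilate b O a.
Proof.
split => [|ba _ [x Ox <-]]; first by apply; exact: dilate_self.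
by rewrite mulrC; exact: dilate_mull.
Qed.

Lemma dilate_unit a : O a -> a * a^*%C = 1 -> dilate a O = O.
Proof.
move=> Oa a1; apply/seteqP; split; first exact: dilate_sub.
by move=> x Ox; exists (a^*%C * x); [apply: orderM => //; exact: order_conj|rewrite mulrA a1 mul1r].
Qed.

(** The cosets are numbered by the residues modulo k of the two coordinates. *)
Lemma index_int (k : nat) : (0 < k)%N -> has_index O (dilate k%:R O) (k ^ 2).
Proof.
move=> k0; have gkO := dilate_subgroup k%:R order_subgroup.
apply/(has_indexP _ _ gkO).
have /choice[f fP] : forall z, exists c : int * int, O z -> z = c.1%:~R + c.2%:~R * w.
  move=> z; have [[x [y zE]]|nz] := pselect (O z); first by exists (x, y).
  by exists (0, 0).
have fE x y : f (x%:~R + y%:~R * w) = (x, y).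
  have /order_inj[] := fP (x%:~R + y%:~R * w) (ex_intro _ x (ex_intro _ y erefl)).
  by case: (f _) => x' y' /= -> ->.
have kz : (k%:Z != 0) by rewrite eqz_nat -lt0n.
have mk (x : int) : `|(x %% k)%Z|%:Z = (x %% k)%Z :> int by rewrite gez0_abs// modz_ge0.
have mlt (x : int) : (`|(x %% k)%Z| < k)%N.
  by rewrite -ltz_nat mk ltz_pmod.
exists (fun z => `|((f z).1 %% k)%Z| * k + `|((f z).2 %% k)%Z|)%N; split.
- by move=> z _; have := mlt (f z).1; have := mlt (f z).2; nia.
- move=> m mk2; exists ((m %/ k)%N%:~R + (m %% k)%N%:~R * w); first by do 2 eexists.
  rewrite fE /= !modz_nat !absz_nat modn_mod [in X in (X * _)%N]modn_small ?ltn_divLR ?mulnn//.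
  by rewrite -divn_eq.
move=> _ _ [x [y ->]] [x' [y' ->]]; rewrite !fE /=; split => [e|[_ [u [v ->]] e]].
  have ex : `|(x %% k)%Z|%N = `|(x' %% k)%Z|%N.
    by have := congr1 (divn^~ k) e; rewrite !divnMDl// !divn_small// !addn0.
  have ey : `|(y %% k)%Z|%N = `|(y' %% k)%Z|%N.
    by have := congr1 (modn^~ k) e; rewrite !modnMDl !modn_small.
  have /eqP := congr1 Posz ex; rewrite !mk eqz_mod_dvd => /dvdzP[u ue].
  have /eqP := congr1 Posz ey; rewrite !mk eqz_mod_dvd => /dvdzP[v ve].
  exists (u%:~R + v%:~R * w); first by do 2 eexists.
  have -> : x = x' + u * k by rewrite -ue; ring.
  have -> : y = y' + v * k by rewrite -ve; ring.
  by rewrite !(rmorphD, rmorphM)/=; ring.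
have /order_inj[ex ey] : (u * k)%:~R + (v * k)%:~R * w = (x - x')%:~R + (y - y')%:~R * w.
  transitivity (k%:R * (u%:~R + v%:~R * w)); first by rewrite !rmorphM/=; ring.
  by rewrite e !rmorphB/=; ring.
have -> : x = u * k + x' by rewrite ex subrK.
have -> : y = v * k + y' by rewrite ey subrK.
by rewrite !modzMDl.
Qed.

(** Conjugation maps a O to conj a O, so both have the same index k in O; the
    chain N(a) O = a conj(a) O, a O, O then gives k^2 = [O : N(a) O] = N(a)^2. *)
Lemma index_principal a (m : nat) : O a -> a != 0 -> a * a^*%C = m%:R ->
  has_index O (dilate a O) m.
Proof.
move=> Oa a0 am.
have gO := order_subgroup; have gaO := dilate_subgroup a gO.
have m0 : (0 < m)%N.
  rewrite lt0n; apply: contra a0 => /eqP m0; move: am; rewrite m0 => /eqP.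
  by rewrite mulf_eq0 conjc_eq0 orbb.
have OmO := index_int m0.
have aE : dilate m%:R O = dilate a (dilate a^*%C O) by rewrite dilateM am.
have maO : dilate m%:R O `<=` dilate a O.
  by rewrite aE; apply/(dilate_subset _ _ a0)/dilate_sub/order_conj.
have [k Ok] := has_index_exists maO gaO (dilate_subgroup _ gO) OmO.
have k_conj : has_index O (dilate a^*%C O) k.
  rewrite -{1}order_conj_im.
  have -> : dilate a^*%C O = (@conjc R) @` (dilate a O).
    apply/seteqP; split => [_ [x Ox <-]|_ [_ [x Ox <-] <-]].
      exists (a * x^*%C); last by rewrite rmorphM/= conjcK.
      by exists x^*%C; [exact: order_conj|].
    by exists x^*%C; [exact: order_conj|rewrite rmorphM].
  apply: (@has_index_image _ _ (@conjc R)) => //; try exact: conjcK;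
    by move=> x y; rewrite rmorphB.
have OmO' : has_index O (dilate m%:R O) (k * k).
  apply: (has_index_trans gO gaO _ (dilate_sub Oa) maO Ok).
    exact: dilate_subgroup.
  by rewrite aE; apply/has_index_dilate => //; exact: dilate_subgroup.
have /eqP := has_index_unique OmO OmO'; rewrite mulnn eqn_exp2r// => /eqP mk.
by rewrite mk.
Qed.

Lemma norm_ler (a b : C) (k l : nat) : a * a^*%C = k%:R -> b * b^*%C = l%:R ->
  (`|a| <= `|b|) = (k <= l)%N.
Proof.
move=> ak bl; rewrite -(@ler_pXn2r _ 2) ?nnegrE ?normr_ge0// !sqr_normc ak bl.
by rewrite ler_nat.
Qed.

Lemma shortest_element I : nonzero_ideal O I ->
  exists a, [/\ I a, a != 0 & forall b, I b -> b != 0 -> `|a| <= `|b|].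
Proof.
move=> [IO gI IM [x Ix x0]].
have ex : exists k : nat, `[< exists z, [/\ I z, z != 0 & z * z^*%C = k%:R] >].
  by have [k xk] := order_norm (IO _ Ix); exists k; apply/asboolP; exists x.
case: (ex_minnP ex) => k /asboolP[a [Ia a0 ak]] min_k; exists a; split => // b Ib b0.
have [l bl] := order_norm (IO _ Ib).
by rewrite (norm_ler ak bl) min_k//; apply/asboolP; exists b.
Qed.

Lemma intr_nat (k : nat) : (k%:Z)%:~R = k%:R :> C. Proof. by []. Qed.

Section Ideal.
Variables (I : set C) (a : C).
Hypotheses (gI : additive_subgroup I) (IM : forall x y, O x -> I y -> I (x * y)).
Hypotheses (Ia : I a) (a0 : a != 0).
Hypothesis a_min : forall b, I b -> b != 0 -> `|a| <= `|b|.

(** Otherwise, for s the residue of r modulo p, the element a s / p of I would be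
    nonzero and shorter than a. *)
Lemma no_fraction b (p : nat) (r : int) : (0 < p)%N -> I b ->
  p%:R * b = a * r%:~R -> (p %| r)%Z.
Proof.
move=> p0 Ib e; apply/dvdz_mod0P; apply/eqP; apply: contraT => s0.
set s := (r %% p)%Z in s0; have pz : p%:Z != 0 by rewrite eqz_nat -lt0n.
have s_ge0 : 0 <= s by exact: modz_ge0.
have s_lt : s < p by rewrite ltz_pmod.
pose b' := b - (r %/ p)%Z%:~R * a.
have Ib' : I b' by apply: subgroupB => //; apply: IM => //; exact: order_int.
have e' : p%:R * b' = a * s%:~R.
  have rE : r%:~R = (r %/ p)%Z%:~R * p%:R + s%:~R :> C.
    by rewrite {1}(divz_eq r p) rmorphD rmorphM.
  by rewrite mulrBr e rE; ring.
have b'0 : b' != 0.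
  apply: contra s0 => /eqP b'0; move/eqP: e'; rewrite b'0 mulr0 eq_sym mulf_eq0.
  by rewrite (negbTE a0) /= intr_eq0.
have := a_min Ib' b'0.
have pp : 0 < p%:R :> C by rewrite ltr0n.
rewrite -(ler_pM2l pp) -[X in X * `|b'|]normr_nat -normrM e' normrM.
rewrite mulrC ler_pM2l ?normr_gt0// ger0_norm ?ler0z//.
rewrite -[p%:R]/(p%:Z%:~R) ler_int => /(lt_le_trans s_lt).
by rewrite ltxx.
Qed.

(** The inequality compares the lengths of b and a; the divisibility is
    [no_fraction] for the product of b and the conjugate of x + w. *)
Lemma no_small_fraction b (p : nat) (x : int) : prime p -> I b ->
  p%:R * b = a * (x%:~R + w) -> (p ^ 2)%:Z <= qform x 1 /\ (p %| qform x 1)%Z.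
Proof.
move=> pp Ib e; have p0 := prime_gt0 pp.
have xw : x%:~R + w = x%:~R + 1%:~R * w by rewrite mul1r.
have Oxw : O (x%:~R + w) by rewrite xw; exists x, 1.
have Nxw : (x%:~R + w) * (x%:~R + w)^*%C = (qform x 1)%:~R by rewrite xw norm_order.
have q0 : qform x 1 != 0 by apply/eqP => /qform_eq0[].
have xw0 : x%:~R + w != 0.
  by apply: contra q0 => /eqP e0; move/eqP: Nxw; rewrite e0 mul0r eq_sym intr_eq0.
split; last first.
  apply: (@no_fraction ((x%:~R + w)^*%C * b)) => //.
    by apply: IM => //; exact: order_conj.
  by rewrite mulrCA e -Nxw; ring.
have b0 : b != 0.
  apply/eqP => b0; move/eqP: e; rewrite b0 mulr0 eq_sym mulf_eq0.
  by rewrite (negbTE a0) (negbTE xw0).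
have := a_min Ib b0.
have pC : 0 < p%:R :> C by rewrite ltr0n.
rewrite -(ler_pM2l pC) -[X in X * `|b|]normr_nat -normrM e normrM.
rewrite mulrC ler_pM2l ?normr_gt0// -(@ler_pXn2r _ 2) ?nnegrE ?normr_ge0 ?ler0n//.
by rewrite sqr_normc Nxw -natrX -[_%:R]/((p ^ 2)%:Z%:~R) ler_int.
Qed.

End Ideal.

(** All the primes below the bound that lattice reduction gives are inert; this
    is how class number one enters. *)
Hypothesis small_primes : forall p : nat, prime p -> (3 * p ^ 2)%:Z <= 4 * n - t ^+ 2 ->
  forall x : int, ~~ (p %| qform x 1)%Z.

(** After this reduction of x modulo p, the norm of x + w is at most
    (p^2 + 4 n - t^2) / 4. *)
Lemma centered_rep (p : nat) (x : int) : (0 < p)%N ->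
  exists k : int, `|2 * (x - k * p) + t| <= p.
Proof.
move=> p0; exists ((2 * x + t + p) %/ (2 * p))%Z.
have pz : (2 * p)%:Z != 0 by lia.
have := divz_eq (2 * x + t + p) (2 * p)%:Z.
have := modz_ge0 (2 * x + t + p) pz.
have : ((2 * x + t + p) %% (2 * p)%:Z)%Z < (2 * p)%:Z by rewrite ltz_pmod; lia.
move: ((2 * x + t + p) %% (2 * p)%:Z)%Z ((2 * x + t + p) %/ (2 * p)%:Z)%Z => r q.
by rewrite ler_norml; lia.
Qed.

(** Let a be a shortest element of I, and suppose that a O is not I. Then some c
    in I outside a O satisfies p c = a (x + y w) with p prime. If p divides y,
    subtracting a multiple of a leads to y = 0; then p divides x by [no_fraction],
    so c was in a O. If not, multiplying by an inverse of y modulo p leads to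
    y = 1 and |2 x + t| <= p; then [no_small_fraction] gives
    p^2 <= N(x + w) <= (p^2 + D) / 4 with D = 4 n - t^2, hence 3 p^2 <= D, while p
    divides N(x + w). *)
Lemma order_pid I : nonzero_ideal O I -> exists a, [/\ O a, a != 0 & I = dilate a O].
Proof.
move=> nI; have [IO gI IM _] := nI.
have [a [Ia a0 a_min]] := shortest_element nI.
exists a; split; [exact: IO|exact: a0|]; apply/seteqP; split; last first.
  by move=> _ [x Ox <-]; rewrite mulrC; exact: IM.
move=> b Ib; apply: contrapT => nab.
have [k ak] := order_norm (IO _ Ia).
have k0 : (0 < k)%N.
  rewrite lt0n; apply: contra a0 => /eqP k0; move: ak; rewrite k0 => /eqP.
  by rewrite mulf_eq0 conjc_eq0 orbb.
have ex : exists q : nat, (0 < q)%N && `[< dilate a O (q%:R * b) >].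
  exists k; rewrite k0; apply/asboolP; exists (a^*%C * b); last by rewrite mulrA ak.
  by apply: orderM; [apply: order_conj; exact: IO|exact: IO].
case: (ex_minnP ex) => q /andP[q0 /asboolP aqb] min_q.
have q1 : (1 < q)%N.
  by rewrite ltn_neqAle q0 andbT; apply/eqP => q1; apply: nab; rewrite -q1 mul1r in aqb.
have pp := pdiv_prime q1; set p := pdiv q in pp; have p0 := prime_gt0 pp.
have [r qE] : exists r, q = (r * p)%N by apply/dvdnP; exact: pdiv_dvd.
have r0 : (0 < r)%N by move: q0; rewrite qE muln_gt0 => /andP[].
pose c := r%:R * b.
have Ic : I c by apply: IM => //; exact: order_nat.
have nac : ~ dilate a O c.
  move=> ac; have : (q <= r)%N by apply: min_q; rewrite r0; apply/asboolP.
  by rewrite qE leqNgt -[ltnLHS]muln1 ltn_pmul2l// prime_gt1.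
have [_ [x [y ->]] pc] : exists2 z, O z & p%:R * c = a * z.
  by case: aqb => z Oz zE; exists z => //; rewrite zE qE natrM [r%:R * _]mulrC mulrA.
have pz : p%:Z != 0 by rewrite eqz_nat -lt0n.
have pC : p%:R != 0 :> C by rewrite pnatr_eq0 -lt0n.
case: (boolP (p %| y)%Z) => [/dvdzP[y' yE]|py].
  have Ic' : I (c - y'%:~R * w * a).
    apply: subgroupB => //; apply: IM => //.
    by apply: orderM; [exact: order_int|exact: order_w].
  have /(no_fraction gI IM Ia a0 a_min p0 Ic') : p%:R * (c - y'%:~R * w * a) = a * x%:~R.
    by rewrite mulrBr pc yE rmorphM/= intr_nat; ring.
  move=> /dvdzP[x' xE]; apply: nac; exists (x'%:~R + y'%:~R * w); first by do 2 eexists.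
  by apply: (mulfI pC); rewrite pc xE yE !rmorphM/= !intr_nat; ring.
have cop : coprimez y p by rewrite coprimez_sym coprimezE prime_coprime.
have [[u v] /= uv] := coprimezP _ _ cop.
have [j jP] := centered_rep (u * x) p0.
set x' := u * x - j * p in jP.
(* p c' = a (x' + w), by u y + v p = 1 and x' = u x - j p *)
pose c' := u%:~R * c + (v%:~R * w - j%:~R) * a.
have Ic' : I c'.
  apply: subgroupD => //; first by apply: IM => //; exact: order_int.
  by apply: IM => //; apply: orderB; [apply: orderM; [exact: order_int|exact: order_w]|exact: order_int].
have pc' : p%:R * c' = a * (x'%:~R + w).
  have -> : p%:R * c' = u%:~R * (p%:R * c) + p%:R * ((v%:~R * w - j%:~R) * a) by rewrite /c'; ring.
  have e1 : u%:~R * y%:~R + v%:~R * p%:R = 1 :> C.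
    by rewrite -[p%:R]/(p%:Z%:~R) -!rmorphM -rmorphD uv.
  have -> : x'%:~R + w = u%:~R * x%:~R - j%:~R * p%:R + (u%:~R * y%:~R + v%:~R * p%:R) * w.
    by rewrite e1 mul1r /x' rmorphB !rmorphM.
  by rewrite pc; ring.
have [qp pq] := no_small_fraction gI IM Ia a0 a_min pp Ic' pc'.
have : (3 * p ^ 2)%:Z <= 4 * n - t ^+ 2.
  have := qform4 x' 1; rewrite !(mulr1, expr1n).
  have : (2 * x' + t) ^+ 2 <= p%:Z ^+ 2.
    by rewrite -real_normK ?num_real// lerXn2r ?nnegrE ?normr_ge0.
  have -> : (3 * p ^ 2)%:Z = 3 * p%:Z ^+ 2 by rewrite PoszM -mulnn PoszM expr2.
  lia.
by move=> /(small_primes pp)/(_ x'); rewrite pq.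
Qed.

Lemma order_bezout a b : O a -> O b -> a != 0 -> exists g u v,
  [/\ O u, O v, g = a * u + b * v & [/\ O g, g != 0, dilate g O a & dilate g O b]].
Proof.
move=> Oa Ob a0; pose I := [set z | exists u v, [/\ O u, O v & z = a * u + b * v]].
have [] := @order_pid I.
  split.
  - by move=> _ [u [v [Ou Ov ->]]]; apply: orderD; exact: orderM.
  - split; first by exists 0, 0; split; [exact: order0|exact: order0|rewrite !mulr0 addr0].
    move=> _ _ [u [v [Ou Ov ->]]] [u' [v' [Ou' Ov' ->]]].
    by exists (u - u'), (v - v'); split; [exact: orderB|exact: orderB|ring].
  - move=> x _ Ox [u [v [Ou Ov ->]]].
    by exists (x * u), (x * v); split; [exact: orderM|exact: orderM|ring].
  - exists a => //; exists 1, 0.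
    by split; [exact: order1|exact: order0|rewrite mulr0 mulr1 addr0].
move=> g [Og g0 IE].
have [u [v [Ou Ov gE]]] : I g by rewrite IE; exact: dilate_self.
exists g, u, v; split => //; split => //; rewrite -IE.
  by exists 1, 0; split; [exact: order1|exact: order0|rewrite mulr0 mulr1 addr0].
by exists 0, 1; split; [exact: order0|exact: order1|rewrite mulr0 mulr1 add0r].
Qed.

Definition principal_ideals (m : nat) : set (set C) :=
  [set L | exists a, [/\ O a, a * a^*%C = m%:R & L = dilate a O]].
Local Notation S := principal_ideals.

Lemma norm_mul a b (k l : nat) : a * a^*%C = k%:R -> b * b^*%C = l%:R ->
  (a * b) * (a * b)^*%C = (k * l)%:R.
Proof. by move=> ak bl; rewrite rmorphM/= mulrACA ak bl natrM. Qed.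

Lemma norm_nat (k : nat) : k%:R * (k%:R)^*%C = (k ^ 2)%:R :> C.
Proof. by rewrite conjc_nat -natrM mulnn. Qed.

Lemma norm_conj a (k : nat) : a * a^*%C = k%:R -> a^*%C * a^*%C^*%C = k%:R.
Proof. by move=> ak; rewrite conjcK mulrC. Qed.

Lemma norm_cancel a b (k l : nat) : (0 < k)%N -> O b -> a * a^*%C = k%:R ->
  (a * b) * (a * b)^*%C = (k * l)%:R -> b * b^*%C = l%:R.
Proof.
move=> k0 Ob ak; have [j bj] := order_norm Ob.
rewrite (norm_mul ak bj) => /eqP; rewrite eqr_nat eqn_pmul2l// => /eqP jl.
by rewrite bj jl.
Qed.

Lemma norm_neq0 a (k : nat) : (0 < k)%N -> a * a^*%C = k%:R -> a != 0.
Proof.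
move=> k0 ak; apply/eqP => a0; move/eqP: ak; rewrite a0 mul0r eq_sym pnatr_eq0.
by rewrite eqn0Ngt k0.
Qed.

Lemma conj_dilate a b : dilate a O b -> dilate a^*%C O b^*%C.
Proof. by move=> [x Ox <-]; exists x^*%C; [exact: order_conj|rewrite rmorphM]. Qed.

Lemma dilate_principal p L m k : O p -> p * p^*%C = k%:R -> S m L -> S (k * m) (dilate p L).
Proof.
move=> Op pk [a [Oa am ->]]; exists (p * a); rewrite dilateM.
by split; [exact: orderM|exact: norm_mul|].
Qed.

(** From 4 m = (2 x + t y)^2 + D y^2 where D = 4 n - t^2 >= 1, both
    2 x + t y and y are at most 4 m in absolute value; they determine x and y. *)
Lemma finite_principal m : finite_set (S m).
Proof.
(* h recovers the lattice from the shifted values of 2 x + t y and y *)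
pose K := (4 * m)%N.
pose h (c : nat * nat) : set C :=
  let y := c.2%:Z - K%:Z in let x := ((c.1%:Z - K%:Z - t * y) %/ 2)%Z in
  dilate (x%:~R + y%:~R * w) O.
have fin : finite_set (`I_(2 * K).+1 `*` `I_(2 * K).+1) by apply: finite_setX; exact: finite_II.
apply: sub_finite_set (finite_image h fin) => _ [_ [[x [y ->]] am ->]].
have qm : qform x y = m by apply/eqP; rewrite -(eqr_int C) -norm_order am.
have e := qform4 x y; rewrite qm in e.
set X := 2 * x + t * y in e.
have X2 := sqr_ge0 X; have Y2 := mulr_ge0 (ltW disc_gt0) (sqr_ge0 y).
have Xm : `|X| <= K.
  rewrite /K; suff : X ^+ 2 <= (4 * m)%:Z by rewrite ler_norml; nia.
  by rewrite PoszM; lia.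
have Ym : `|y| <= K.
  rewrite /K; suff : y ^+ 2 <= (4 * m)%:Z by rewrite ler_norml; nia.
  have : y ^+ 2 <= (4 * n - t ^+ 2) * y ^+ 2 by rewrite ler_peMl ?sqr_ge0//; lia.
  by rewrite PoszM; lia.
exists (`|(X + K)%R|%N, `|(y + K)%R|%N) => /=; first by rewrite ler_norml in Xm; rewrite ler_norml in Ym; split => /=; lia.
rewrite /h /= !gez0_abs ?addrK; [|by rewrite ler_norml in Ym; lia|by rewrite ler_norml in Xm; lia].
by rewrite mulKz.
Qed.

Definition num_principal m := num_sets (S m).
Local Notation f := num_principal.

Lemma num_principal1 : f 1 = 1%N.
Proof.
rewrite /num_principal; have -> : S 1 = [set O]; last exact: num_sets1.
apply/seteqP; split => [_ [a [Oa a1 ->]]|_ ->] /=; first exact: dilate_unit.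
by exists 1; split; [exact: order1|rewrite conjc1 mulr1|rewrite dilate1].
Qed.

Lemma num_dilate a (T : set (set C)) : a != 0 ->
  num_sets (dilate a @` T) = num_sets T.
Proof. by move=> a0; apply: num_sets_image; exact: dilate_inj. Qed.

(** If p b has norm p m, then p N(b) = m. *)
Lemma multiples_of_prime p m : (0 < p)%N -> (0 < m)%N ->
  [set L | exists b, [/\ O b, (p%:R * b) * (p%:R * b)^*%C = (p * m)%:R & L = dilate (p%:R * b) O]]
  = (if (p %| m)%N then dilate p%:R @` S (m %/ p) else set0).
Proof.
move=> p0 m0; apply/seteqP; split => [_ [b [Ob + ->]]|].
  have [j bj] := order_norm Ob.
  rewrite (norm_mul (norm_nat p) bj) => /eqP; rewrite eqr_nat expnS expn1 -mulnA eqn_pmul2l//.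
  move=> /eqP <-; rewrite dvdn_mulr// mulKn//; exists (dilate b O); last by rewrite dilateM.
  by exists b.
case: ifPn => [/dvdnP[k ->]|_]; last exact: sub0set.
rewrite mulnK// => _ [_ [b [Ob bk ->]] <-].
exists b; split=> //; last by rewrite dilateM.
by rewrite (norm_mul (norm_nat p) bk) expnS expn1 -mulnA [(k * p)%N]mulnC.
Qed.

Lemma num_multiples_of_prime p m : (0 < p)%N ->
  num_sets (if (p %| m)%N then dilate p%:R @` S (m %/ p) else set0) = coef_shift p f m.
Proof.
move=> p0; rewrite /coef_shift; case: ifP => _; last exact: num_sets0.
by apply: num_dilate; rewrite pnatr_eq0 -lt0n.
Qed.

(** An inert p divides every element whose norm it divides. *)
Lemma hecke_inert p m : prime p -> (0 < m)%N ->
  (forall x y, (p %| qform x y)%Z -> (p %| x)%Z && (p %| y)%Z) ->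
  f (p * m) = coef_shift p f m.
Proof.
move=> pp m0 inertp; have p0 := prime_gt0 pp.
rewrite -num_multiples_of_prime// -multiples_of_prime//; congr num_sets.
apply/seteqP; split => [_ [_ [[x [y ->]] + ->]]|_ [b [Ob bm ->]]]; last first.
  by exists (p%:R * b); split => //; apply: orderM => //; exact: order_nat.
rewrite norm_order => /eqP am.
have /andP[/dvdzP[x' xE] /dvdzP[y' yE]] : (p %| x)%Z && (p %| y)%Z.
  apply: inertp; move: am; rewrite -intr_nat eqr_int => /eqP ->.
  by rewrite dvdzE /= dvdn_mulr.
have aE : x%:~R + y%:~R * w = p%:R * (x'%:~R + y'%:~R * w).
  by rewrite xE yE !rmorphM/= intr_nat; ring.
exists (x'%:~R + y'%:~R * w); split; [by do 2 eexists| |by rewrite aE].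
by rewrite -aE norm_order; exact/eqP.
Qed.

(** A greatest common divisor of pi and a has norm 1 or p, and in the second case
    it is associated with pi. *)
Lemma coprime_prime_elt pi p a : O pi -> prime p -> pi * pi^*%C = p%:R -> O a -> ~ dilate pi O a ->
  exists u v, [/\ O u, O v & 1 = a * u + pi * v].
Proof.
move=> Opi pp pi_norm Oa npa; have p0 := prime_gt0 pp.
have [g [u [v [Ou Ov gE [Og g0 [c Oc cE] ga]]]]] := order_bezout Opi Oa (norm_neq0 p0 pi_norm).
have [k gk] := order_norm Og; have [l cl] := order_norm Oc.
have klp : (k * l = p)%N by apply/eqP; rewrite -(eqr_nat C) -(norm_mul gk cl) cE pi_norm.
have [k1|k1] := eqVneq k 1%N.
  exists (v * g^*%C), (u * g^*%C); split; try by apply: orderM => //; exact: order_conj.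
  rewrite k1 in gk; rewrite -[LHS]gk {1}gE; ring.
have kp : k = p.
  have kp : (k %| p)%N by rewrite -klp dvdn_mulr.
  by case/primeP: pp => _ /(_ _ kp); rewrite (negbTE k1) => /eqP.
have c1 : c * c^*%C = 1.
  by move/eqP: klp; rewrite cl kp -[X in _ == X]muln1 eqn_pmul2l// => /eqP ->.
have gpi : g = pi * c^*%C by rewrite -cE -mulrA c1 mulr1.
case: ga => b Ob bE; case: npa; exists (c^*%C * b); last by rewrite mulrA -gpi.
by apply: orderM => //; exact: order_conj.
Qed.

Section PrimeNorm.
Variables (pi : C) (p : nat).
Hypotheses (Opi : O pi) (pp : prime p) (pi_norm : pi * pi^*%C = p%:R).

Let p0 : (0 < p)%N. Proof. exact: prime_gt0. Qed.
Let pi0 : pi != 0. Proof. exact: norm_neq0 pi_norm. Qed.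

(** Otherwise both a and its conjugate are coprime to pi, and hence so is their
    product p m, which pi divides. *)
Lemma prime_elt_dvd a (m : nat) : O a -> a * a^*%C = (p * m)%:R ->
  dilate pi O a \/ dilate pi^*%C O a.
Proof.
move=> Oa am; have [|na] := pselect (dilate pi O a); first by left.
right; apply: contrapT => na'.
have [u [v [Ou Ov e]]] := coprime_prime_elt Opi pp pi_norm Oa na.
have [|u' [v' [Ou' Ov' e']]] := @coprime_prime_elt _ _ a^*%C Opi pp pi_norm (order_conj Oa).
  by move=> /conj_dilate; rewrite conjcK.
(* the product of the two Bezout relations, in which a conj(a) = pi conj(pi) m *)
pose z := pi^*%C * m%:R * u * u' + v * (a^*%C * u') + (a * u) * v' + v * pi * v'.
have Oz : O z.
  have := order_conj Oa; have := order_conj Opi; have := order_nat m => Om Opi' Oa'.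
  by do ![apply: orderD|apply: orderM].
have z1 : pi * z = 1.
  rewrite -[RHS]mulr1 {1}e {1}e' /z.
  have : a * a^*%C = pi * pi^*%C * m%:R by rewrite am pi_norm natrM.
  move: a^*%C pi^*%C => a' pi' ha; ring: ha.
have [k zk] := order_norm Oz.
have /eqP := norm_mul pi_norm zk; rewrite z1 conjc1 mulr1 -[1]/(1%:R) eqr_nat eq_sym muln_eq1.
by move=> /andP[/eqP p1]; move: (pp); rewrite p1.
Qed.

Lemma principal_prime_split m :
  S (p * m) = dilate pi @` S m `|` dilate pi^*%C @` S m.
Proof.
apply/seteqP; split => [_ [a [Oa am ->]]|L].
  case: (prime_elt_dvd Oa am) => -[b Ob e]; [left|right];
    (exists (dilate b O); last by rewrite dilateM e);
    exists b; split=> //.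
    by apply: (norm_cancel p0 Ob pi_norm); rewrite e.
  by apply: (norm_cancel p0 Ob (norm_conj pi_norm)); rewrite e.
case=> -[L' SL' <-]; first exact: dilate_principal.
by apply: dilate_principal => //; [exact: order_conj|exact: norm_conj].
Qed.

Lemma hecke_ramified m : dilate pi O pi^*%C -> f (p * m) = f m.
Proof.
move=> [e Oe eE]; rewrite /num_principal principal_prime_split.
rewrite -[RHS](num_dilate _ pi0); congr num_sets; apply/setUidPl => _ [_ [b [Ob bm ->]] <-].
have e1 : e * e^*%C = 1%:R.
  by apply: (norm_cancel p0 Oe pi_norm); rewrite eE muln1; exact: norm_conj.
exists (dilate (e * b) O); last by rewrite !dilateM mulrA eE.
by exists (e * b); split=> //; [exact: orderM|rewrite -[m]mul1n; exact: norm_mul].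
Qed.

(** Inclusion and exclusion: an ideal of norm p m is divisible by pi or by its
    conjugate, and by p if it is divisible by both, as they are coprime. *)
Lemma hecke_split m : (0 < m)%N -> ~ dilate pi O pi^*%C ->
  (f (p * m) + coef_shift p f m = f m + f m)%N.
Proof.
move=> m0 npi.
have pi'0 : pi^*%C != 0 by rewrite conjc_eq0.
transitivity (num_sets (dilate pi @` S m) + num_sets (dilate pi^*%C @` S m))%N; last first.
  by rewrite !num_dilate.
rewrite -num_setsU; try by apply: finite_image; exact: finite_principal.
rewrite -principal_prime_split; congr (_ + _)%N.
rewrite -num_multiples_of_prime// -multiples_of_prime//; congr num_sets.
apply/seteqP; split => [_ [b [Ob bm ->]]|_ [[_ [b [Ob bm ->]] <-] [_ [c [Oc cm ->]]]]].
  have Opi' := order_conj Opi.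
  split.
    exists (dilate (pi^*%C * b) O); last by rewrite dilateM mulrA pi_norm.
    exists (pi^*%C * b); split=> //; first exact: orderM.
    by apply: (norm_cancel p0 (orderM Opi' Ob) pi_norm); rewrite mulrA pi_norm.
  exists (dilate (pi * b) O); last by rewrite dilateM mulrA [_ * pi]mulrC pi_norm.
  exists (pi * b); split=> //; first exact: orderM.
  by apply: (norm_cancel p0 (orderM Opi Ob) (norm_conj pi_norm)); rewrite mulrA [_ * pi]mulrC pi_norm.
rewrite !dilateM => e.
have [z Oz zE] : dilate pi^*%C O (pi * b).
  have [c' Oc' <-] : dilate (pi^*%C * c) O (pi * b) by rewrite e; exact: dilate_self.
  by exists (c * c'); [exact: orderM|rewrite mulrA].
have npi' : ~ dilate pi^*%C O pi by move/conj_dilate; rewrite conjcK.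
have [u [v [Ou Ov uv]]] := coprime_prime_elt (order_conj Opi) pp (norm_conj pi_norm) Opi npi'.
have bE : b = pi^*%C * (z * u + v * b).
  by rewrite -[LHS]mul1r uv; ring: zE.
have pE : p%:R * (z * u + v * b) = pi * b by rewrite -pi_norm -mulrA -bE.
exists (z * u + v * b); split; [|by rewrite pE; exact: norm_mul|by rewrite pE].
by apply: orderD; exact: orderM.
Qed.

End PrimeNorm.

(** The ideals of norm m left by a sieve by the rational primes below k. *)
Definition primitive_upto (k m : nat) : set (set C) :=
  [set L | S m L /\ forall q, prime q -> (q < k)%N -> ~ L `<=` dilate q%:R O].

Definition primitive_principal (m : nat) : set (set C) :=
  [set L | S m L /\ forall q, prime q -> ~ L `<=` dilate q%:R O].

Lemma finite_primitive_upto k m : finite_set (primitive_upto k m).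
Proof. by apply: sub_finite_set (finite_principal m) => L []. Qed.

Lemma multiple_prime_norm q a (m : nat) : (0 < m)%N -> dilate q%:R O a -> a * a^*%C = m%:R ->
  exists b, [/\ O b, a = q%:R * b & exists2 k : nat, b * b^*%C = k%:R & m = (q ^ 2 * k)%N].
Proof.
move=> m0 [b Ob <-] am; exists b; split => //.
have [k bk] := order_norm Ob; exists k => //.
by apply/eqP; rewrite -(eqr_nat C) -am (norm_mul (norm_nat q) bk).
Qed.

Lemma primitive_upto0 m : primitive_upto 0 m = S m.
Proof. by apply/seteqP; split => [L []|L SL] //; split. Qed.

Lemma primitive_upto_gt k m : (0 < m < k)%N -> primitive_upto k m = primitive_principal m.
Proof.
move=> /andP[m0 mk]; apply/seteqP; split => L [SL prL]; split => // q qp; last first.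
  by move=> _; exact: prL.
have [qk|kq] := ltnP q k; first exact: prL.
case: SL => a [Oa am ->] /dilate_le qa.
have [b [_ _ [j _ mE]]] := multiple_prime_norm m0 qa am.
have j0 : (0 < j)%N by move: m0; rewrite mE muln_gt0 => /andP[].
have := leq_trans mk kq; rewrite mE expnS expn1 -mulnA ltnNge leq_pmulr//.
by rewrite muln_gt0 prime_gt0.
Qed.

Lemma primitive_upto_nonprime k m : ~~ prime k -> primitive_upto k.+1 m = primitive_upto k m.
Proof.
move=> npk; apply/seteqP; split => L [SL prL]; split => // q qp qk.
  by apply: prL => //; exact: ltnW.
by apply: prL => //; rewrite ltn_neqAle -ltnS qk andbT; apply: contraNneq npk => <-.
Qed.

Lemma coprime_nat_dilate (p q : nat) b : coprime p q -> O b ->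
  dilate q%:R O (p%:R * b) -> dilate q%:R O b.
Proof.
move=> cop Ob [c Oc cE].
have [[u v] /= uv] := coprimezP p q cop.
have e1 : u%:~R * p%:R + v%:~R * q%:R = 1 :> C by rewrite -!intr_nat -!rmorphM -rmorphD uv.
exists (u%:~R * c + v%:~R * b).
  by apply: orderD; apply: orderM => //; exact: order_int.
by rewrite -[RHS]mul1r -[X in _ = X * _]e1; ring: cE.
Qed.

(** The ideals that the prime p removes are the p L with L of norm m / p^2 left
    by the primes below p. *)
Lemma primitive_upto_prime p m : prime p -> (0 < m)%N ->
  (num_sets (primitive_upto p.+1 m) +
   coef_shift (p ^ 2) (fun m => num_sets (primitive_upto p m)) m =
   num_sets (primitive_upto p m))%N.
Proof.
move=> pp m0; have p0 := prime_gt0 pp.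
pose T := if (p ^ 2 %| m)%N then dilate p%:R @` primitive_upto p (m %/ p ^ 2) else set0.
have -> : coef_shift (p ^ 2) (fun m => num_sets (primitive_upto p m)) m = num_sets T.
  rewrite /coef_shift /T; case: ifP => _; last by rewrite num_sets0.
  by rewrite num_dilate// pnatr_eq0 -lt0n.
have finT : finite_set T.
  rewrite /T; case: ifP => _; last exact: finite_set0.
  by apply: finite_image; exact: finite_primitive_upto.
have disj : primitive_upto p.+1 m `&` T = set0.
  rewrite -subset0 => L [[_ /(_ _ pp (ltnSn _))]]; rewrite /T; case: ifP => // _ npL.
  case=> _ [[b [Ob _ ->]] _] e; apply: npL; rewrite -e.
  by apply/dilate_subset; [rewrite pnatr_eq0 -lt0n|exact: dilate_sub].
rewrite -num_setsU ?finite_primitive_upto//; last exact: finite_primitive_upto.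
rewrite disj num_sets0 addn0; congr num_sets; apply/seteqP; split => L.
  case=> [[SL prL]|]; first by split=> // q qp qk; apply: prL => //; exact: ltnW.
  rewrite /T; case: ifP => // /dvdnP[k ->]; rewrite mulnK ?expn_gt0 ?p0//.
  case=> _ [[b [Ob bk ->]] prb] <-; rewrite dilateM; split.
    exists (p%:R * b); split=> //; first by apply: orderM => //; exact: order_nat.
    by rewrite (norm_mul (norm_nat p) bk) mulnC.
  move=> q qp qk /dilate_le qb; apply: (prb _ qp qk); apply/dilate_le.
  apply: coprime_nat_dilate qb => //.
  by rewrite coprime_sym prime_coprime// dvdn_prime2//; rewrite ltn_eqF.
case=> SL prL; have [Lp|nLp] := pselect (L `<=` dilate p%:R O); [right|left]; last first.
  split=> // q qp; rewrite ltnS leq_eqVlt => /orP[/eqP ->//|]; exact: prL.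
case: SL prL Lp => a [Oa am ->] prL /dilate_le pa.
have [b [Ob aE [k bk mE]]] := multiple_prime_norm m0 pa am.
rewrite /T mE dvdn_mulr// mulKn ?expn_gt0 ?p0//.
exists (dilate b O); last by rewrite dilateM -aE.
split; first by exists b.
move=> q qp qk /dilate_le qb; apply: (prL _ qp qk); apply/dilate_le.
by rewrite aE; apply: dilate_mull => //; exact: order_nat.
Qed.

Lemma ssl_principal m : (0 < m)%N -> [set L | is_ssl O L /\ has_index O L m] = S m.
Proof.
move=> m0; apply/seteqP; split => [L [[LO [a a0 LE]] Lm]|L [a [Oa am LE]]].
  move: LO Lm; rewrite LE => aO aind.
  have Oa : O a by apply: aO; exact: dilate_self.
  have [k ak] := order_norm Oa.
  have mk := has_index_unique aind (index_principal Oa a0 ak).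
  by exists a; rewrite mk.
rewrite LE; have a0 := norm_neq0 m0 am; split; last exact: index_principal.
by split; [exact: dilate_sub|exists a].
Qed.

Lemma ideal_principal m : (0 < m)%N -> [set I | nonzero_ideal O I /\ has_index O I m] = S m.
Proof.
move=> m0; rewrite -ssl_principal//; apply/seteqP; split => [I [nI Im]|L [[LO [a a0 LE]] Lm]].
  have [a [Oa a0 IE]] := order_pid nI.
  by split=> //; split; [case: nI|exists a].
split=> //; split=> //; rewrite LE; first exact: dilate_subgroup order_subgroup.
  by move=> x y Ox ay; exact: dilate_mull.
by exists a; [exact: dilate_self|].
Qed.

(** If u / v, in lowest terms, maps a O into O, then v divides a by Bezout, and so
    does every prime factor of v. *)
Lemma primitive_in_order a : O a -> a != 0 ->
  primitive_in O (dilate a O) <-> forall q, prime q -> ~ dilate a O `<=` dilate q%:R O.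
Proof.
move=> Oa a0; split => [pra q qp|pra x xa].
  move=> /dilate_le[b Ob bE].
  have qC : q%:R != 0 :> C by rewrite pnatr_eq0 -lt0n prime_gt0.
  have : (q%:R^-1 : rat) \is a Num.int.
    apply: pra; rewrite dilateM fmorphV rmorph_nat -bE mulKf//; exact: dilate_sub.
  move=> /intrP[j jE].
  have : (q%:Z * j) = 1.
    apply/eqP; rewrite -(eqr_int rat) rmorphM/= -jE.
    by rewrite divff// pnatr_eq0 -lt0n prime_gt0.
  move=> qj; have : (q%:Z %| 1)%Z by apply/dvdzP; exists j; rewrite mulrC.
  by rewrite dvdz1 absz_nat => /eqP q1; move: qp; rewrite q1.
have den0 : (denq x)%:~R != 0 :> C by rewrite intr_eq0 denq_eq0.
have [c Oc cE] : exists2 c, O c & (numq x)%:~R * a = (denq x)%:~R * c.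
  exists (ratr x * a); first by apply: xa; exists a => //; exact: dilate_self.
  by rewrite /ratr mulrA [_ * (_ / _)]mulrC divfK.
have [[u v] /= uv] := coprimezP (numq x) (denq x) (coprime_num_den x).
have e1 : u%:~R * (numq x)%:~R + v%:~R * (denq x)%:~R = 1 :> C by rewrite -!rmorphM -rmorphD uv.
have aE : a = (denq x)%:~R * (u%:~R * c + v%:~R * a).
  by rewrite -[LHS]mul1r -[X in X * _ = _]e1; ring: cE.
have Ob : O (u%:~R * c + v%:~R * a) by apply: orderD; apply: orderM => //; exact: order_int.
have [d1|d1] := eqVneq (denq x) 1.
  by rewrite -[x]divq_num_den d1 divr1 intr_int.
have dgt1 : (1 < `|denq x|)%N by have := denq_gt0 x; lia.
case: (pra _ (pdiv_prime dgt1)); apply/dilate_le.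
have [j jE] : exists j, denq x = (pdiv `|denq x|)%:Z * j.
  have /dvdnP[j jE] := pdiv_dvd `|denq x|.
  by exists j%:Z; rewrite -PoszM mulnC -jE gez0_abs// ltW// denq_gt0.
exists (j%:~R * (u%:~R * c + v%:~R * a)); first by apply: orderM => //; exact: order_int.
by rewrite [RHS]aE [in RHS]jE rmorphM/= mulrA.
Qed.

Lemma primitive_ssl_principal m : (0 < m)%N ->
  [set L | [/\ is_ssl O L, primitive_in O L & has_index O L m]] = primitive_principal m.
Proof.
move=> m0; apply/seteqP; split => [L [sL pL iL]|L [SL pL]].
  have SL : S m L by rewrite -ssl_principal.
  split=> //; by case: SL pL => a [Oa am ->] /(primitive_in_order Oa (norm_neq0 m0 am)).
have [sL iL] : is_ssl O L /\ has_index O L m by move: SL; rewrite -ssl_principal.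
split=> //; case: SL pL => a [Oa am ->] pL; exact/(primitive_in_order Oa (norm_neq0 m0 am)).
Qed.

End QuadraticOrder.

(** * The ring of integers *)
Section RingOfIntegers.
Variable R : realType.
Local Notation C := R[i].
Import complex.

Lemma ratrE : ((forall x y, (ratr (x - y) = ratr x - ratr y :> C)%R)
  * (forall x y, (ratr (x + y) = ratr x + ratr y :> C)%R)
  * (forall x y, (ratr (x * y) = ratr x * ratr y :> C)%R)
  * (forall x k, (ratr (x ^+ k) = ratr x ^+ k :> C)%R)
  * (forall x, (ratr x^-1 = (ratr x)^-1 :> C)%R)
  * (forall k : int, (ratr k%:~R = k%:~R :> C)%R)
  * (forall k : nat, (ratr k%:R = k%:R :> C)%R))%type.
Proof.
split; last exact: ratr_nat.
split; last exact: ratr_int.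
split; last exact: fmorphV.
split; last by move=> x k; exact: rmorphXn.
split; last exact: rmorphM.
by split; [exact: rmorphB|exact: rmorphD].
Qed.

(** Rationality and integrality are transported to the algebraic numbers, where
    rational algebraic integers are known to be integers. *)
Lemma integral_rat (q : rat) : integralOver (intr : int -> C) (ratr q) -> exists k : int, q = k%:~R.
Proof.
move=> [p p_monic rp]; apply/intrP.
have rq : root (map_poly intr p : {poly rat}) q.
  rewrite -(fmorph_root (ratr : {rmorphism rat -> C})) -map_poly_comp.
  by rewrite (eq_map_poly (g := intr)) // => x /=; rewrite ratr_int.
have qA : (ratr q : algC) \in Aint.
  apply: (@root_monic_Aint (map_poly intr p)).
  - move: rq; rewrite -(fmorph_root (ratr : {rmorphism rat -> algC})) -map_poly_comp.
    by rewrite (eq_map_poly (g := intr)) // => x /=; rewrite ratr_int.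
  - exact: monic_map.
  - by apply/polyOverP => i; rewrite coef_map /= intr_int.
have /intrP[k kE] := Cint_rat_Aint (Crat_rat q) qA.
apply/intrP; exists k; have : ratr q = ratr k%:~R :> algC by rewrite kE ratr_int.
exact: fmorph_inj.
Qed.

Lemma integral_conj z : integralOver (intr : int -> C) z -> integralOver (intr : int -> C) z^*%C.
Proof.
move=> [p p_monic rp]; exists p => //.
rewrite (eq_map_poly (g := @conjc R \o intr)); last by move=> x /=; rewrite rmorph_int.
by rewrite map_poly_comp rmorph_root.
Qed.

(** The square of the denominator of q divides the squarefree number c. *)
Lemma rat_sqr_int (c : nat) (q : rat) (k : int) : c = 1%N \/ prime c ->
  c%:R * q ^+ 2 = k%:~R -> exists y : int, q = y%:~R.
Proof.
move=> cP e; apply/intrP.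
have den0 : (denq q)%:~R != 0 :> rat by rewrite intr_eq0 denq_eq0.
have e' : c%:Z * numq q ^+ 2 = k * denq q ^+ 2.
  apply/eqP; rewrite -(eqr_int rat) !expr2 !rmorphM/= numqE -e; apply/eqP.
  by rewrite -[c%:~R]/(c%:R); ring.
have dv : (denq q ^+ 2 %| c%:Z)%Z.
  rewrite -(@Gauss_dvdzl _ _ (numq q ^+ 2)).
    by rewrite e'; apply: dvdz_mull; exact: dvdzz.
  by rewrite coprimezXl// coprimezXr// coprimez_sym coprimezE coprime_num_den.
have d1 : denq q = 1.
  have d0 := denq_gt0 q; rewrite -[denq q]gez0_abs ?ltW//; congr (_%:Z).
  move: dv; rewrite dvdzE abszX absz_nat => dv.
  case: cP => [c1|cp]; first by move: dv; rewrite c1 dvdn1 -mulnn muln_eq1 => /andP[/eqP].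
  have dc : (`|denq q| %| c)%N by apply: dvdn_trans dv; rewrite expnS dvdn_mulr.
  case/primeP: (cp) => c1 /(_ _ dc)/orP[/eqP//|/eqP dE].
  by move: dv; rewrite dE -[X in (_ %| X)%N]expn1 dvdn_Pexp2l.
by rewrite -[q]divq_num_den d1 divr1 intr_int.
Qed.

Lemma quadratic_order_integral (w : C) (t n : int) : w + w^*%C = t%:~R ->
  w * w^*%C = n%:~R -> quadratic_order w `<=` integralOver (intr : int -> C).
Proof.
move=> wt wn.
have iw : integralOver (intr : int -> C) w.
  exists ('X^2 - (t%:P * 'X - n%:P)).
    rewrite monicE lead_coefDl ?lead_coefXn// size_polyXn size_polyN ltnS.
    rewrite (leq_trans (size_polyD _ _))// geq_max size_polyN (leq_trans (size_polyC_leq1 _))// andbT.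
    by rewrite mul_polyC (leq_trans (size_scale_leq _ _))// size_polyX.
  rewrite rootE rmorphB rmorphXn rmorphB rmorphM/= map_polyX !map_polyC/= !hornerE -wt -wn.
  by apply/eqP; ring.
move=> _ [x [y ->]]; apply: integral_add; first exact: integral_id.
by apply: integral_mul => //; exact: integral_id.
Qed.

Variables (t n : int).
Hypothesis tn : t = 1 /\ prime `|(4 * n - 1)%R| \/ t = 0 /\ (n = 1 \/ n = 2).
Let d := t - 4 * n.
Hypothesis d_lt0 : d < 0.

Let delta : C := sqrtC d%:~R.
Definition omega : C := (t%:~R + sqrtC (t - 4 * n)%:~R) / 2.
Local Notation w := omega.

Lemma delta_sqr : delta ^+ 2 = d%:~R.
Proof. exact: sqrtCK. Qed.

Lemma delta_conj : delta^*%C = - delta.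
Proof.
have : (delta^*%C) ^+ 2 == delta ^+ 2 by rewrite -rmorphXn delta_sqr rmorph_int.
rewrite eqf_sqr => /orP[/eqP e|/eqP//].
have := mulcJ_ge0 delta; rewrite e -expr2 delta_sqr ler0z; lia.
Qed.

Lemma omega_conj : w^*%C = (t%:~R - delta) / 2.
Proof.
rewrite /omega -/d -/delta.
transitivity ((t%:~R + delta)^*%C * (2^-1)^*%C); first exact: rmorphM.
rewrite conjc_inv conjc_nat; congr (_ / _); rewrite -delta_conj.
transitivity ((t%:~R)^*%C + delta^*%C); first exact: rmorphD.
by rewrite conjc_int.
Qed.

Lemma omega_trace : w + w^*%C = t%:~R.
Proof.
rewrite omega_conj /omega -/d -/delta.
by field.
Qed.

Lemma t_sqr : t * t = t. Proof. by case: tn => -[-> _]. Qed.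

Lemma omega_norm : w * w^*%C = n%:~R.
Proof.
rewrite omega_conj /omega -/d -/delta.
have -> : n%:~R = ((t * t)%:~R - d%:~R) / 4 :> C.
  by rewrite t_sqr /d rmorphB rmorphM/=; field.
by rewrite -delta_sqr rmorphM/=; field.
Qed.

(** If a + b sqrt d is integral, its trace A = 2 a and its norm N = a^2 - d b^2
    are integers, and A^2 - d (2 b)^2 = 4 N. As d is squarefree, up to a factor 4
    when t = 0, this makes 2 b (or 4 b when t = 0) an integer, and the equation
    modulo 4 settles the parities. *)
Lemma ring_of_integersE : ring_of_integers (quadratic_field R d) = quadratic_order w.
Proof.
apply/seteqP; split => z; last first.
  move=> Oz; split; last exact: quadratic_order_integral omega_trace omega_norm _ Oz.
  case: Oz => x [y ->].
  exists (x%:~R + y%:~R * t%:~R / 2), (y%:~R / 2).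
  rewrite /omega -/d -/delta !ratrE.
  by field.
move=> [[a [b zE]] iz]; rewrite -/delta in zE.
have zJ : z^*%C = ratr a - ratr b * delta.
  transitivity ((ratr a)^*%C + (ratr b * delta)^*%C); first by rewrite zE; exact: rmorphD.
  rewrite -mulrN -delta_conj; congr (_ + _); first exact: fmorph_rat.
  transitivity ((ratr b)^*%C * delta^*%C); first exact: rmorphM.
  by congr (_ * _); exact: fmorph_rat.
have [A AE] : exists A : int, 2 * a = A%:~R.
  apply: integral_rat; rewrite (_ : ratr _ = z + z^*%C); last first.
    by rewrite zJ zE !ratrE; ring.
  exact: integral_add iz (integral_conj iz).
have [N NE] : exists N : int, a ^+ 2 - d%:~R * b ^+ 2 = N%:~R.
  apply: integral_rat; rewrite (_ : ratr _ = z * z^*%C); last first.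
    by rewrite zJ zE !ratrE -delta_sqr; ring.
  exact: integral_mul iz (integral_conj iz).
suff [x [y [aE bE]]] : exists x y : int, a = x%:~R + y%:~R * t%:~R / 2 /\ b = y%:~R / 2.
  exists x, y; rewrite zE aE bE /omega -/d -/delta.
  rewrite !ratrE.
  by field.
have two0 : 2 != 0 :> rat by [].
have four0 : 4 != 0 :> rat by [].
case: tn => [[t1 pn]|[t0 n12]].
  have [y yE] : exists y : int, 2 * b = y%:~R.
    apply: (@rat_sqr_int `|(4 * n - 1)%R|%N _ (4 * N - A ^+ 2)); first by right.
    have -> : (`|(4 * n - 1)%R|%N%:R : rat) = (4 * n - 1)%:~R.
      by rewrite natr_absz ger0_norm//; move: d_lt0; rewrite /d t1; lia.
    have -> : (4 * N - A ^+ 2)%:~R = 4 * N%:~R - A%:~R ^+ 2 :> rat.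
      by rewrite rmorphB rmorphM rmorphXn.
    by rewrite -NE -AE /d t1 !(rmorphB, rmorphM)/=; ring.
  have e : A ^+ 2 - (1 - 4 * n) * y ^+ 2 = 4 * N.
    apply/eqP; rewrite -(eqr_int rat); apply/eqP.
    by rewrite !(rmorphB, rmorphXn, rmorphM)/= -NE -AE -yE /d t1 !(rmorphB, rmorphM)/=; ring.
  have [x xE] : exists x : int, A = y + 2 * x.
    by exists ((A - y) %/ 2)%Z; nia.
  exists x, y; rewrite t1; split.
    by apply: (mulfI two0); rewrite AE xE rmorphD rmorphM/=; field.
  by apply: (mulfI two0); rewrite yE; field.
have [Y YE] : exists Y : int, 4 * b = Y%:~R.
  apply: (@rat_sqr_int `|n|%N _ (4 * N - A ^+ 2)).
    by case: n12 => ->; [left|right].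
  have -> : (`|n|%N%:R : rat) = n%:~R by case: n12 => ->.
  have -> : (4 * N - A ^+ 2)%:~R = 4 * N%:~R - A%:~R ^+ 2 :> rat.
    by rewrite rmorphB rmorphM rmorphXn.
  by rewrite -NE -AE /d t0 !(rmorphB, rmorphM)/=; ring.
have e : A ^+ 2 + n * Y ^+ 2 = 4 * N.
  apply/eqP; rewrite -(eqr_int rat); apply/eqP.
  by rewrite !(rmorphD, rmorphXn, rmorphM)/= -NE -AE -YE /d t0 !(rmorphB, rmorphM)/=; ring.
have [x [y [xE yE]]] : exists x y : int, A = 2 * x /\ Y = 2 * y.
  have := divz_eq A 2; have := modz_ge0 A (isT : 2 != 0 :> int); have := ltz_pmod A (isT : 0 < 2 :> int).
  have := divz_eq Y 2; have := modz_ge0 Y (isT : 2 != 0 :> int); have := ltz_pmod Y (isT : 0 < 2 :> int).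
  move: (A %% 2)%Z (A %/ 2)%Z (Y %% 2)%Z (Y %/ 2)%Z => r x s y s2 s0 YE' r2 r0 AE'.
  exists x, y; move: e; rewrite AE' YE'.
  have [->|->] : r = 0 \/ r = 1 by lia.
    have [->|->] : s = 0 \/ s = 1 by lia.
      by move=> _; lia.
    by case: n12 => ->; lia.
  have [->|->] : s = 0 \/ s = 1 by lia.
    by case: n12 => ->; lia.
  by case: n12 => ->; lia.
exists x, y; rewrite t0 mulr0 mul0r addr0; split.
  by apply: (mulfI two0); rewrite AE xE rmorphM/=; ring.
by apply: (mulfI four0); rewrite YE yE rmorphM/=; field.
Qed.

End RingOfIntegers.

(** * Decomposition of the rational primes *)
Section PrimeDecomposition.
Variable R : realType.
Local Notation C := R[i].
Import complex.
Variables (w : C) (t n : int).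
Hypothesis w_trace : w + w^*%C = t%:~R.
Hypothesis w_norm : w * w^*%C = n%:~R.
Hypothesis tn : t = 1 /\ prime `|(4 * n - 1)%R|%N \/ t = 0 /\ (n = 1 \/ n = 2).
Hypothesis disc_gt0 : 0 < 4 * n - t ^+ 2.
Hypothesis small_primes : forall p : nat, prime p -> (3 * p ^ 2)%:Z <= 4 * n - t ^+ 2 ->
  forall x : int, ~~ (p %| qform t n x 1)%Z.
Local Notation O := (quadratic_order w).
Local Notation d := (t - 4 * n).
Local Notation f := (num_principal w).

Lemma chiE p : prime p -> chi d p = chi_prime d p.
Proof.
move=> pp; rewrite /chi prime_decompE primes_prime//= big_seq1 /= logn_prime// eqxx expr1.
by case: p pp.
Qed.

Lemma disc_qform x y : 4 * qform t n x y = (2 * x + t * y) ^+ 2 - d * y ^+ 2.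
Proof. by rewrite qform4; case: tn => -[-> _]; ring. Qed.

Lemma dvdz_prime_mul (p : nat) (x y : int) : prime p -> (p %| x * y)%Z = (p %| x)%Z || (p %| y)%Z.
Proof. by move=> pp; rewrite !dvdzE abszM Euclid_dvdM. Qed.

Lemma dvdz4 (p : nat) (x : int) : prime p -> p != 2%N -> (p %| 4 * x)%Z = (p %| x)%Z.
Proof.
move=> pp p2; rewrite -[4]/(2 * 2 : int) -mulrA !dvdz_prime_mul//.
by have -> : (p %| 2)%Z = false by rewrite dvdzE /= dvdn_prime2// (negbTE p2).
Qed.

Lemma odd_disc : ~~ (2 %| d)%Z -> t = 1.
Proof. by case: tn => -[-> //]; rewrite sub0r dvdzE /= abszN abszM dvdn_mulr. Qed.

(** A square root x0 of d modulo p gives a zero modulo p of the norm form, by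
    solving 2 x + t = x0. *)
Lemma chi_split_root p : prime p -> chi_prime d p = 1 -> exists x : int, (p %| qform t n x 1)%Z.
Proof.
move=> pp; rewrite /chi_prime; case: ifPn => // pd; case: eqP => [p2|/eqP p2].
  rewrite p2 in pd *; have t1 := odd_disc pd.
  case: eqP => // d8 _; exists 0; rewrite /qform t1 !(mulr0, mulr1, expr1n, expr0n, add0r).
  apply/dvdzP; exists (n %/ 2)%Z; move: d8; rewrite t1; lia.
rewrite /legendre (negbTE pd); case: ifP => // /existsP[x0 x0P] _.
have podd : odd p by case: (even_prime pp) p2 => [->|].
(* k.+1 is the inverse of 2 modulo p = 2 k + 1 *)
have [k pk] : exists k : nat, p = k.*2.+1 by exists p./2; rewrite -[LHS]odd_double_half podd.
exists ((x0%:Z - t) * k.+1%:Z); rewrite -(dvdz4 _ pp p2) disc_qform mulr1 expr1n mulr1.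
move: x0P; rewrite eqz_mod_dvd => x0P.
have -> : (2 * ((x0%:Z - t) * k.+1%:Z) + t) ^+ 2 - d = (x0%:Z ^+ 2 - d) +
   p%:Z * ((x0%:Z - t) * (2 * ((x0%:Z - t) * k.+1%:Z) + t + x0%:Z)).
  have -> : p%:Z = 2 * k%:Z + 1 by rewrite pk; lia.
  rewrite -[k.+1]addn1 PoszD; ring.
by rewrite rpredD// dvdz_mulr.
Qed.

(** A greatest common divisor of p and x + w has a norm that divides p^2. It is
    not p^2, as p does not divide x + w; and it is not 1, as then p would divide
    the conjugate of x + w, p being a divisor of N(x + w). *)
Lemma prime_norm_element p x : prime p -> (p %| qform t n x 1)%Z ->
  exists2 pi, O pi & pi * pi^*%C = p%:R.
Proof.
move=> pp /dvdzP[q qE]; have p0 := prime_gt0 pp.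
have Op : O p%:R := order_nat w p.
have Ox : O (x%:~R + w) by exists x, 1; rewrite mul1r.
have pC : p%:R != 0 :> C by rewrite pnatr_eq0 -lt0n.
have nx : (x%:~R + w) * (x%:~R + w)^*%C = p%:R * q%:~R.
  have := norm_order w_trace w_norm x 1; rewrite mul1r => ->.
  by rewrite qE rmorphM/= mulrC.
have notp (y e : int) (z : C) : `|e|%N = 1%N -> O z -> p%:R * z <> y%:~R + e%:~R * w.
  move=> e1 [u [v ->]] E.
  have /(order_inj w_trace w_norm disc_gt0)[_ ev] :
      (p%:Z * u)%:~R + (p%:Z * v)%:~R * w = y%:~R + e%:~R * w.
    by rewrite -E !rmorphM/= -[(p%:Z)%:~R]/(p%:R); ring.
  move: e1; rewrite -ev abszM absz_nat => /eqP; rewrite muln_eq1 => /andP[/eqP p1 _].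
  by move: pp; rewrite p1.
have [g [u [v [Ou Ov gE [Og g0 [c Oc cE] [c' Oc' cE']]]]]] :=
  order_bezout w_trace w_norm disc_gt0 small_primes Op Ox pC.
have [k gk] := order_norm w_trace w_norm disc_gt0 Og.
have [l cl] := order_norm w_trace w_norm disc_gt0 Oc.
have kl : (k * l = p ^ 2)%N.
  by apply/eqP; rewrite -(eqr_nat C) -(norm_mul gk cl) cE norm_nat.
have kp2 : (k %| p ^ 2)%N by rewrite -kl dvdn_mulr.
have /(dvdn_pfactor _ _ pp)[i i2 kE] := kp2.
case: i i2 kE => [|[|[|//]]] _ kE; last first.
- have l1 : l = 1%N.
    by apply/eqP; rewrite -(eqn_pmul2l (_ : 0 < k)%N) ?kl ?kE ?expn_gt0 ?p0// muln1.
  have gp : g = p%:R * c^*%C by rewrite -cE -mulrA cl l1 mulr1.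
  have := notp x 1 (c^*%C * c') erefl.
  rewrite mul1r mulrA -gp cE'; case=> //.
  by apply: (orderM w_trace w_norm) => //; exact: (order_conj w_trace).
- by exists g => //; rewrite gk kE expn1.
have Oxc := order_conj w_trace Ox.
have Og' := order_conj w_trace Og.
have xE : (x%:~R + w)^*%C = (x + t)%:~R + (-1)%:~R * w.
  transitivity ((x%:~R : C)^*%C + w^*%C); first exact: rmorphD.
  by rewrite conjc_int (conj_w w_trace) rmorphD rmorphN/=; ring.
case: (notp (x + t) (-1) (((x%:~R + w)^*%C * u + q%:~R * v) * g^*%C)) => //.
  apply: (orderM w_trace w_norm) => //; apply: orderD; apply: (orderM w_trace w_norm) => //.
  exact: order_int.
rewrite -xE [RHS](_ : _ = (x%:~R + w)^*%C * ((p%:R * u + (x%:~R + w) * v) * g^*%C)).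
  move: nx; move: (x%:~R + w) (x%:~R + w)^*%C => a a' nx; ring: nx.
by rewrite -gE gk kE expn0 mulr1.
Qed.

(** If pi divides its conjugate, it divides its trace T, and p divides T. Then
    4 p = T^2 - d y^2 shows that p divides y and that p^2 divides 4 p, so p = 2;
    this contradicts d = 1 modulo 8. *)
Lemma split_not_ramified p pi : prime p -> chi_prime d p = 1 -> O pi -> pi * pi^*%C = p%:R ->
  ~ dilate pi O pi^*%C.
Proof.
move=> pp chip Opi; have [x [y piE]] := Opi; rewrite piE => pn [z Oz zE].
have p0 := prime_gt0 pp.
have pq : qform t n x y = p by apply/eqP; rewrite -(eqr_int C) -(norm_order w_trace w_norm) pn.
have tr : (x%:~R + y%:~R * w) * (1 + z) = (2 * x + t * y)%:~R.
  rewrite mulrDr mulr1 zE.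
  have -> : (x%:~R + y%:~R * w)^*%C = x%:~R + y%:~R * w^*%C.
    transitivity ((x%:~R : C)^*%C + (y%:~R * w)^*%C); first exact: rmorphD.
    rewrite conjc_int; congr (_ + _).
    transitivity ((y%:~R : C)^*%C * w^*%C); first exact: rmorphM.
    by rewrite conjc_int.
  by rewrite rmorphD !rmorphM/= -w_trace; ring.
have [k zk] := order_norm w_trace w_norm disc_gt0 (orderD (order1 w) Oz).
have pT : (p %| 2 * x + t * y)%Z.
  have : (p %| (2 * x + t * y) ^+ 2)%Z.
    have H : (2 * x + t * y)%:~R ^+ 2 = (p * k)%:R :> C.
      by rewrite -(norm_mul pn zk) tr conjc_int expr2.
    by apply/dvdzP; exists k%:Z; apply/eqP; rewrite -(eqr_int C) rmorphXn/= H -PoszM mulnC.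
  by rewrite expr2 dvdz_prime_mul// orbb.
have e := disc_qform x y; rewrite pq in e.
case/dvdzP: pT => T TE; rewrite TE in e.
have pd : ~~ (p %| d)%Z by move: chip; rewrite /chi_prime; case: ifP.
have py : (p %| y)%Z.
  have : (p %| d * y ^+ 2)%Z.
    by apply/dvdzP; exists (T * T * p - 4); move: e; lia.
  by rewrite dvdz_prime_mul// (negbTE pd) /= expr2 dvdz_prime_mul// orbb.
case/dvdzP: py => Y YE; rewrite YE in e.
have e' : 4 = p%:Z * (T ^+ 2 - d * Y ^+ 2).
  by apply: (mulIf (_ : p%:Z != 0)); [rewrite eqz_nat -lt0n|rewrite e; ring].
have [p2|p2] := eqVneq p 2%N; last first.
  have : (p %| 4 * 1)%Z by rewrite mulr1 e' dvdz_mulr.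
  by rewrite dvdz4// dvdzE /= dvdn1 => /eqP p1; move: pp; rewrite p1.
have d8 : (d %% 8)%Z = 1 by move: chip; rewrite /chi_prime (negbTE pd) p2 /=; case: eqP.
rewrite p2 in pd e'; have t1 := odd_disc pd; rewrite t1 in d8 e'.
have [m nE] : exists m : int, n = 2 * m by exists (n %/ 2)%Z; lia.
have := divz_eq T 2; have := modz_ge0 T (isT : 2 != 0 :> int); have := ltz_pmod T (isT : 0 < 2 :> int).
have := divz_eq Y 2; have := modz_ge0 Y (isT : 2 != 0 :> int); have := ltz_pmod Y (isT : 0 < 2 :> int).
move: (T %% 2)%Z (T %/ 2)%Z (Y %% 2)%Z (Y %/ 2)%Z => r a s b s2 s0 YE' r2 r0 TE'.
move: e'; rewrite YE' TE' nE.
have [->|->] : r = 0 \/ r = 1 by lia.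
  have [->|->] : s = 0 \/ s = 1 by lia.
    by lia.
  by lia.
have [->|->] : s = 0 \/ s = 1 by lia.
  by lia.
by lia.
Qed.

(** If p is odd and does not divide y, then (2 x + t y) / y is a square root of d
    modulo p; for p = 2 it is a matter of parities. *)
Lemma chi_inert p : prime p -> chi_prime d p = -1 ->
  forall x y, (p %| qform t n x y)%Z -> (p %| x)%Z && (p %| y)%Z.
Proof.
move=> pp chip x y pq.
have pd : ~~ (p %| d)%Z by move: chip; rewrite /chi_prime; case: ifP.
have py : (p %| y)%Z.
  apply: contraT => npy; exfalso.
  have [p2|p2] := eqVneq p 2%N.
    rewrite p2 in pd npy pq; have t1 := odd_disc pd.
    move: chip; rewrite /chi_prime p2 eqxx (negbTE pd); case: eqP => // d8 _.
    have [m nE] : exists m : int, n = 2 * m + 1.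
      by exists ((n - 1) %/ 2)%Z; move: d8; rewrite t1; lia.
    have [v yE] : exists v : int, y = 2 * v + 1.
      by exists ((y - 1) %/ 2)%Z; move: npy; rewrite dvdzE; lia.
    case/dvdzP: pq => q; rewrite /qform t1 nE yE.
    have := divz_eq x 2; have := modz_ge0 x (isT : 2 != 0 :> int).
    have := ltz_pmod x (isT : 0 < 2 :> int).
    move: (x %% 2)%Z (x %/ 2)%Z => r a r2 r0 ->.
    have [->|->] : r = 0 \/ r = 1 by lia.
      by lia.
    by lia.
  have p0 := prime_gt0 pp; have pz : p%:Z != 0 by rewrite eqz_nat -lt0n.
  have cop : coprimez y p by rewrite coprimez_sym coprimezE prime_coprime.
  have [[u v] /= uv] := coprimezP _ _ cop.
  move: chip; rewrite /chi_prime (negbTE pd) (negbTE p2) /legendre (negbTE pd).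
  case: ifPn => // /negP ne _; apply: ne; apply/existsP.
  pose a := (2 * x + t * y) * u; pose r := `|(a %% p)%Z|%N.
  have rE : r%:Z = (a %% p)%Z by rewrite /r gez0_abs// modz_ge0.
  have rp : (r < p)%N by rewrite -ltz_nat rE ltz_pmod.
  exists (Ordinal rp) => /=; rewrite rE modzXm eqz_mod_dvd.
  have -> : a ^+ 2 - d = 4 * qform t n x y * u ^+ 2 - p%:Z * (d * v * (u * y + 1)).
    apply/eqP; rewrite -subr_eq0 disc_qform /a; apply/eqP.
    transitivity (d * (u * y + 1) * (u * y + v * p%:Z - 1)); first by ring.
    by rewrite uv subrr mulr0.
  apply: rpredB; last by apply: dvdz_mulr; exact: dvdzz.
  by apply: dvdz_mulr; apply: dvdz_mull.
rewrite py andbT.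
have : (p %| x ^+ 2)%Z.
  have -> : x ^+ 2 = qform t n x y - y * (t * x + n * y) by rewrite /qform; ring.
  by rewrite rpredB// dvdz_mulr.
by rewrite expr2 dvdz_prime_mul// orbb.
Qed.

(** The ramified prime is the norm of sqrt d if d is odd, of 1 + i if d = -4, and
    of sqrt (-2) if d = -8. *)
Lemma ramified_element p : prime p -> (p %| d)%Z ->
  exists pi, [/\ O pi, pi * pi^*%C = p%:R & dilate pi O pi^*%C].
Proof.
move=> pp pd.
suff [x [y [u [v [q [e1 e2]]]]]] : exists x y u v : int, [/\ qform t n x y = p,
    x + t * y = x * u - n * y * v & - y = x * v + y * u + t * y * v].
  exists (x%:~R + y%:~R * w); split; first by exists x, y.
    by rewrite (norm_order w_trace w_norm) q.
  exists (u%:~R + v%:~R * w); first by exists u, v.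
  transitivity ((x%:~R)^*%C + (y%:~R * w)^*%C : C); last by apply/esym; exact: rmorphD.
  transitivity (x%:~R + y%:~R * (t%:~R - w)); last first.
    rewrite -(conj_w w_trace) conjc_int; congr (_ + _); rewrite -{1}[y%:~R]conjc_int.
    by apply/esym; exact: rmorphM.
  transitivity ((x * u - n * y * v)%:~R + (x * v + y * u + t * y * v)%:~R * w).
    by rewrite !(rmorphB, rmorphD, rmorphM)/=; ring: (w_sqr w_trace w_norm).
  by rewrite -e1 -e2 !(rmorphB, rmorphD, rmorphN, rmorphM)/=; ring.
have p_dvd (k : nat) : prime k -> (p %| k)%N -> p = k.
  by move=> pk; rewrite dvdn_prime2// => /eqP.
case: tn => [[t1 pn]|[t0 n12]].
  have pE : p%:Z = 4 * n - 1.
    have := p_dvd _ pn; rewrite -[(p %| _)%N]/(p%:Z %| 4 * n - 1)%Z => -> //.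
      by rewrite gez0_abs//; move: disc_gt0; rewrite t1; lia.
    have -> : 4 * n - 1 = - d by rewrite t1 opprB.
    by rewrite dvdzE abszN.
  (* sqrt d = 2 w - 1, and its conjugate is its product by -1 *)
  by exists (-1), 2, (-1), 0; rewrite /qform pE t1; split; ring.
have p2 : p = 2%N.
  apply: p_dvd => //; move: pd; rewrite t0 sub0r dvdzE abszN.
  case: n12 => ->.
    by rewrite -[absz (4 * 1)]/(2 ^ 2)%N Euclid_dvdX// => /andP[].
  by rewrite -[absz (4 * 2)]/(2 ^ 3)%N Euclid_dvdX// => /andP[].
rewrite p2 t0; case: n12 => ->.
  (* 1 + w with w = i, and its conjugate is its product by - w *)
  by exists 1, 1, 0, (-1).
(* w = sqrt (-2), and its conjugate is its product by -1 *)
by exists 0, 1, (-1), 0.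
Qed.

(** In the three cases chi p = 0, 1, -1 the recurrence reads f(p m) = f(m),
    f(p m) + f(m / p) = 2 f(m) and f(p m) = f(m / p). *)
Lemma hecke_principal p m : prime p -> (0 < m)%N ->
  (f (p * m))%:Z = (1 + chi d p) * (f m)%:Z - chi d p * (coef_shift p f m)%:Z.
Proof.
move=> pp m0; rewrite chiE//.
have [pd|pd] := boolP (p %| d)%Z.
  have [pi [Opi pin pir]] := ramified_element pp pd.
  rewrite (hecke_ramified w_trace w_norm disc_gt0 small_primes Opi pp pin m pir).
  by rewrite /chi_prime pd; ring.
have [chi1|chiN1] : chi_prime d p = 1 \/ chi_prime d p = -1.
  rewrite /chi_prime /legendre (negbTE pd); case: ifP => _; case: ifP => _; by [left|right].
  have [x px] := chi_split_root pp chi1.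
  have [pi Opi pin] := prime_norm_element pp px.
  have := hecke_split w_trace w_norm disc_gt0 small_primes Opi pp pin m0
    (split_not_ramified pp chi1 Opi pin).
  by rewrite chi1; lia.
rewrite chiN1 (hecke_inert w_trace w_norm disc_gt0 pp m0 (chi_inert pp chiN1)); ring.
Qed.

End PrimeDecomposition.

(** * Dilation of similar sublattices *)
Section SimilarLattices.
Variable R : realType.
Local Notation C := R[i].
Implicit Types (G L : set C) (a : C).

Lemma ssl_dilate a G m : a != 0 -> additive_subgroup G ->
  [set L | is_ssl (dilate a G) L /\ has_index (dilate a G) L m]
  = dilate a @` [set L | is_ssl G L /\ has_index G L m].
Proof.
move=> a0 gG; apply/seteqP; split => [L [[LG [b b0 LE]] Lm]|_ [L [[LG [b b0 LE]] Lm] <-]].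
  have {}LE : L = dilate a (dilate b G) by rewrite LE !dilateM mulrC.
  rewrite {}LE in LG Lm *; exists (dilate b G) => //.
  split; first by split; [exact/(dilate_subset _ _ a0)|exists b].
  by apply/(has_index_dilate _ _ a0) => //; exact: dilate_subgroup.
rewrite {}LE in LG Lm *.
split; last by apply/(has_index_dilate _ _ a0) => //; exact: dilate_subgroup.
split; first exact/(dilate_subset _ _ a0).
by exists b => //; rewrite !dilateM mulrC.
Qed.

Lemma primitive_dilate a G L : a != 0 ->
  primitive_in (dilate a G) (dilate a L) <-> primitive_in G L.
Proof.
move=> a0; split=> pr x; last first.
  by rewrite dilateM mulrC -dilateM => /(dilate_subset _ _ a0); exact: pr.
by move=> xL; apply: pr; rewrite dilateM mulrC -dilateM; exact/(dilate_subset _ _ a0).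
Qed.

Lemma num_ssl_dilate a G m : a != 0 -> additive_subgroup G ->
  num_ssl (dilate a G) m = num_ssl G m.
Proof.
by move=> a0 gG; rewrite /num_ssl ssl_dilate// num_sets_image//; exact: dilate_inj.
Qed.

Lemma num_primitive_ssl_dilate a G m : a != 0 -> additive_subgroup G ->
  num_primitive_ssl (dilate a G) m = num_primitive_ssl G m.
Proof.
move=> a0 gG; rewrite /num_primitive_ssl -[RHS](num_sets_image _ (dilate_inj a0)).
congr num_sets; have e := ssl_dilate m a0 gG; apply/seteqP; split => L.
  move=> [Ls + Li]; have : is_ssl (dilate a G) L /\ has_index (dilate a G) L m by [].
  move: (e) => /(congr1 (fun S => S L)) /= -> [L' [sL' iL'] <-] /(primitive_dilate _ _ a0) pL'.
  by exists L'.
move=> [L' [sL' pL' iL'] <-].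
have : (dilate a @` [set L | is_ssl G L /\ has_index G L m]) (dilate a L') by exists L'.
by rewrite -e => -[sL iL]; split=> //; exact/primitive_dilate.
Qed.

End SimilarLattices.

(** * Comparison of the Euler factors *)
Section EulerFactors.
Variable R : realType.
Local Notation C := R[i].
Import complex.
Implicit Types (s : C).

Lemma euler_product_single (P : pred nat) (F : nat -> C) q :
  (forall p, (prime p && P p) = (p == q)) -> euler_product P F @ \oo --> F q.
Proof.
move=> Pq; apply: cvg_near_cst; exists q.+1 => // n /= qn.
rewrite /euler_product (eq_bigl _ _ Pq) big_mkord.
by rewrite (big_pred1 (Ordinal qn)).
Qed.

Variables (d : int) (q : nat).
Hypothesis chi_prime_val : forall p, prime p -> [\/ chi d p = 0, chi d p = 1 | chi d p = -1].
Hypothesis ramified_q : forall p, (prime p && ramifies d p) = (p == q).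

Lemma euler_product_classes (F Fr Fi Fs : nat -> C) n :
  (forall p, prime p -> chi d p = 0 -> F p = Fr p) ->
  (forall p, prime p -> chi d p = -1 -> F p = Fi p) ->
  (forall p, prime p -> chi d p = 1 -> F p = Fs p) ->
  euler_product xpredT F n =
  euler_product (ramifies d) Fr n * euler_product (inert d) Fi n * euler_product (splits d) Fs n.
Proof.
move=> F0 FN1 F1; rewrite /euler_product.
rewrite big_mkcond [in RHS]big_mkcond [X in _ * X * _]big_mkcond [X in _ * X]big_mkcond.
rewrite -!big_split/=; apply: eq_bigr => p _.
case: (boolP (prime p)) => //= pp; rewrite ?mulr1// /ramifies /inert /splits.
by case: (chi_prime_val pp) => e; rewrite e /= ?mulr1 ?mul1r; [exact: F0|exact: F1|exact: FN1].
Qed.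

(** With X = p^(-s), the factor of D at p is 1 / (1 - X), 1 / (1 - X^2) or
    1 / (1 - X)^2 according to the type of p, and zeta (2 s) contributes
    1 - X^2: the quotients are 1 + X, 1 and (1 + X) / (1 - X). All the limits are
    expressed through those of [euler_product_cvg], which are nonzero. *)
Lemma euler_formulas (f : nat -> nat) s : 1 < Re s ->
  (fun n => \prod_(0 <= p < n | prime p)
     ((1 - cpow p (- s)) * (1 - (chi d p)%:~R * cpow p (- s))) * dirichlet_sum f s)
  @ \oo --> (1 : C) ->
  let F (p : nat) : C := ((1 - cpow p (- s)) * (1 - (chi d p)%:~R * cpow p (- s)))^-1 in
  let Fram (p : nat) : C := (1 - cpow p (- s))^-1 in
  let Finert (p : nat) : C := (1 - cpow p (- (2 * s)))^-1 in
  let Fsplit (p : nat) : C := ((1 - cpow p (- s)) ^+ 2)^-1 in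
  let Fpr (p : nat) : C := (1 + cpow p (- s)) / (1 - cpow p (- s)) in
  exists r i sp pr : C,
  [/\ [/\ euler_product (ramifies d) Fram @ \oo --> r,
          euler_product (inert d) Finert @ \oo --> i
        & euler_product (splits d) Fsplit @ \oo --> sp],
      euler_product xpredT F @ \oo --> r * i * sp,
      dirichlet_sum f s = r * i * sp,
      euler_product (splits d) Fpr @ \oo --> pr
    & dirichlet_sum f s / zeta (2 * s) = (1 + cpow q (- s)) * pr].
Proof.
move=> s1 f_euler F Fram Finert Fsplit Fpr.
have s0 : 0 < Re s by exact: lt_trans ltr01 s1.
have s2 : 1 < Re (2 * s) by rewrite mulr_natl mulr2n raddfD /=; lra.
have s20 : 0 < Re (2 * s) by exact: lt_trans ltr01 s2.
have X1 p : prime p -> 1 - cpow p (- s) != 0 by exact: cpow_neq1.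
have X2 p : prime p -> 1 - cpow p (- s) ^+ 2 != 0.
  by move=> pp; rewrite -cpow_double; exact: cpow_neq1.
have X3 p : prime p -> 1 + cpow p (- s) != 0.
  move=> pp; have := X2 _ pp; apply: contraNneq => e.
  rewrite (_ : 1 - _ = (1 - cpow p (- s)) * (1 + cpow p (- s))); last by ring.
  by rewrite e mulr0.
have qP : prime q && ramifies d q by rewrite ramified_q.
have pq : prime q by case/andP: qP.
have cr := @euler_product_single _ Fram _ ramified_q.
have cr2 := @euler_product_single _ Finert _ ramified_q.
have [i [_ i0] ci] := euler_product_cvg (inert d) s2.
have [l [_ l0] cl] := euler_product_cvg (splits d) s1.
have [l2 [_ l20] cl2] := euler_product_cvg (splits d) s2.
have [z [zE z0] cz] := euler_product_cvg xpredT s2.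
have cs : euler_product (splits d) Fsplit @ \oo --> l * l.
  have -> : euler_product (splits d) Fsplit = fun n =>
      euler_product (splits d) (fun p => (1 - cpow p (- s))^-1) n *
      euler_product (splits d) (fun p => (1 - cpow p (- s))^-1) n.
    apply/funext => n; rewrite /euler_product -big_split/=; apply: eq_bigr => p _.
    by rewrite /Fsplit expr2 invfM.
  exact: (cvgC_mul cl cl).
have cpr : euler_product (splits d) Fpr @ \oo --> l * l * l2^-1.
  have -> : euler_product (splits d) Fpr = fun n => euler_product (splits d) Fsplit n *
      (euler_product (splits d) (fun p => (1 - cpow p (- (2 * s)))^-1) n)^-1.
    apply/funext => n; rewrite /euler_product -prodfV -big_split/=.
    apply: eq_bigr => p /andP[pp _]; rewrite /Fpr /Fsplit invrK cpow_double.
    by field; exact: X1.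
  exact: (cvgC_mul cs (cvgC_inv l20 cl2)).
have cF : euler_product xpredT F @ \oo --> Fram q * i * (l * l).
  have -> : euler_product xpredT F = fun n => euler_product (ramifies d) Fram n *
      euler_product (inert d) Finert n * euler_product (splits d) Fsplit n.
    apply/funext => n; apply: euler_product_classes => p pp e; rewrite /F e.
    - by rewrite mul0r subr0 mulr1.
    - by rewrite /Finert cpow_double; congr (_^-1); rewrite mulN1r; ring.
    - by rewrite /Fsplit mul1r expr2.
  exact: (cvgC_mul (cvgC_mul cr ci) cs).
have czE : z = Finert q * i * l2.
  apply: (cvg_unique (@norm_hausdorff _ C^o) cz).
  have -> : euler_product xpredT (fun p => (1 - cpow p (- (2 * s)))^-1) = fun n =>
      euler_product (ramifies d) Finert n * euler_product (inert d) Finert n *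
      euler_product (splits d) Finert n.
    by apply/funext => n; apply: euler_product_classes.
  exact: (cvgC_mul (cvgC_mul cr2 ci) cl2).
have DE : dirichlet_sum f s = Fram q * i * (l * l).
  have := cvgC_mul cF f_euler; rewrite mulr1.
  have -> : (fun n => euler_product xpredT F n * (\prod_(0 <= p < n | prime p)
     ((1 - cpow p (- s)) * (1 - (chi d p)%:~R * cpow p (- s))) * dirichlet_sum f s))
     = fun=> dirichlet_sum f s.
    apply/funext => n; rewrite mulrA /euler_product.
    rewrite [X in X * _ * _](eq_bigl prime); last by move=> p; rewrite andbT.
    rewrite -big_split/= big1 ?mul1r// => p pp; rewrite /F mulVf// mulf_neq0//; first exact: X1.
    case: (chi_prime_val pp) => ->; rewrite ?mul0r ?subr0 ?oner_neq0// ?mul1r; first exact: X1.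
    by rewrite mulN1r opprK; exact: X3.
  by apply: cvg_unique; [exact: (@norm_hausdorff _ C^o)|exact: cvg_cst].
exists (Fram q), i, (l * l), (l * l * l2^-1); split.
- split; [exact: cr|exact: ci|exact: cs].
- exact: cF.
- exact: DE.
- exact: cpr.
rewrite DE zeta_rough -zE czE /Fram /Finert cpow_double.
by field; rewrite l20 i0 X1// X2.
Qed.

End EulerFactors.

(** * The nine discriminants *)
Section ClassNumberOne.

Lemma qform_residues (t n : int) (p : nat) : (0 < p)%N ->
  (forall r : nat, (r < p)%N -> ~~ (p %| qform t n r 1)%Z) ->
  forall x, ~~ (p %| qform t n x 1)%Z.
Proof.
move=> p0 pr x; have pz : p%:Z != 0 by rewrite eqz_nat -lt0n.
have rE : `|(x %% p)%Z|%N%:Z = (x %% p)%Z by rewrite gez0_abs// modz_ge0.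
have rp : (`|(x %% p)%Z| < p)%N by rewrite -ltz_nat rE ltz_pmod.
apply: contra (pr _ rp) => px; rewrite rE.
have -> : qform t n (x %% p)%Z 1 = qform t n x 1 - (x %/ p)%Z * (x + (x %% p)%Z + t) * p%:Z.
  have := divz_eq x p; move: (x %% p)%Z (x %/ p)%Z => r k ->.
  by rewrite /qform; ring.
by apply: rpredB => //; exact: dvdz_mull.
Qed.

(** As 3 p^2 <= 163, only the primes up to 7 have to be tried. *)
Lemma small_primes_check (t n : int) : 4 * n - t ^+ 2 <= 163 ->
  all (fun p : nat => ((3 * p ^ 2)%:Z <= 4 * n - t ^+ 2) ==>
    all (fun r : nat => ~~ (p %| qform t n r 1)%Z) (iota 0 p)) [:: 2; 3; 5; 7] ->
  forall p : nat, prime p -> (3 * p ^ 2)%:Z <= 4 * n - t ^+ 2 ->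
  forall x, ~~ (p %| qform t n x 1)%Z.
Proof.
move=> n163 check p pp pn; have p0 := prime_gt0 pp.
have p8 : (p < 8)%N.
  have := le_trans pn n163; rewrite lez_nat; case: (ltnP p 8) => // p8.
  by have := leq_mul p8 p8; rewrite -mulnn; lia.
have p_mem : p \in [:: 2; 3; 5; 7].
  by move: p8 pp; clear; case: p => [|[|[|[|[|[|[|[|p]]]]]]]].
apply: qform_residues => // r rp.
by move: (allP check _ p_mem); rewrite pn => /allP; apply; rewrite mem_iota.
Qed.

Lemma class_one_discriminants (d : int) :
  d \in [:: -3; -4; -7; -8; -11; -19; -43; -67; -163 : int] ->
  exists t n : int, [/\ d = t - 4 * n, d < 0,
    t = 1 /\ prime `|(4 * n - 1)%R|%N \/ t = 0 /\ (n = 1 \/ n = 2),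
    0 < 4 * n - t ^+ 2
  & forall p : nat, prime p -> (3 * p ^ 2)%:Z <= 4 * n - t ^+ 2 ->
    forall x, ~~ (p %| qform t n x 1)%Z].
Proof.
have odd_case (n : int) : 0 < 4 * n - 1 <= 163 -> prime `|(4 * n - 1)%R|%N ->
    all (fun p : nat => ((3 * p ^ 2)%:Z <= 4 * n - 1 ^+ 2) ==>
      all (fun r : nat => ~~ (p %| qform 1 n r 1)%Z) (iota 0 p)) [:: 2; 3; 5; 7] ->
    exists t n' : int, [/\ 1 - 4 * n = t - 4 * n', 1 - 4 * n < 0,
    t = 1 /\ prime `|(4 * n' - 1)%R|%N \/ t = 0 /\ (n' = 1 \/ n' = 2),
    0 < 4 * n' - t ^+ 2
  & forall p : nat, prime p -> (3 * p ^ 2)%:Z <= 4 * n' - t ^+ 2 ->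
    forall x, ~~ (p %| qform t n' x 1)%Z].
  move=> /andP[n0 n163] pn check; exists 1, n; split => //; [lia|by left|].
  exact: small_primes_check check.
rewrite !inE.
case/or4P => [/eqP->|/eqP->|/eqP->|].
- exact: (odd_case 1).
- by exists 0, 1; split=> //; [right; split; [|left]|exact: small_primes_check].
- exact: (odd_case 2).
case/or4P => [/eqP->|/eqP->|/eqP->|].
- by exists 0, 2; split=> //; [right; split; [|right]|exact: small_primes_check].
- exact: (odd_case 3).
- exact: (odd_case 5).
case/or3P => /eqP->.
- exact: (odd_case 11).
- exact: (odd_case 17).
- exact: (odd_case 41).
Qed.

End ClassNumberOne.

Section Ramified.
Variables (t n : int).
Local Notation d := (t - 4 * n).
Hypothesis tn : t = 1 /\ prime `|(4 * n - 1)%R|%N \/ t = 0 /\ (n = 1 \/ n = 2).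

Lemma unique_prime_divisor : exists q : nat, forall p, (prime p && (p %| d)%Z) = (p == q).
Proof.
case: tn => [[t1 pn]|[t0 n12]].
  exists `|(4 * n - 1)%R|%N => p; have dE : (p %| d)%Z = (p %| `|(4 * n - 1)%R|)%N.
    by rewrite t1 -opprB dvdzE abszN.
  rewrite dE; apply/andP/eqP => [[pp]|->//]; by rewrite dvdn_prime2// => /eqP.
exists 2%N => p; rewrite t0 sub0r dvdzE abszN.
have dE : exists2 k, (0 < k)%N & absz (4 * n) = (2 ^ k)%N by case: n12 => ->; [exists 2|exists 3].
case: dE => k k0 ->; apply/andP/eqP => [[pp]|->].
  by rewrite Euclid_dvdX// dvdn_prime2// => /andP[/eqP].
by split=> //; rewrite dvdn_exp.
Qed.

Lemma chi_values p : prime p -> [\/ chi d p = 0, chi d p = 1 | chi d p = -1].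
Proof.
move=> pp; rewrite chiE// /chi_prime /legendre.
by do ![case: ifP => _]; by [constructor 1|constructor 2|constructor 3].
Qed.

Lemma ramifiesE p : prime p -> ramifies d p = (p %| d)%Z.
Proof.
move=> pp; rewrite /ramifies chiE// /chi_prime /legendre.
by case: (boolP (p %| d)%Z) => // pd; do ![case: ifP => _].
Qed.

End Ramified.

Theorem proposition3 (R : realType) (d : int)
    (hd : d \in [:: -3; -4; -7; -8; -11; -19; -43; -67; -163 : int]) :
  let OK := ring_of_integers (quadratic_field R d) in
  exists pram : nat,
    [/\ unique (fun p : nat => prime p /\ ramifies d p) pram,
        unique (fun p : nat => prime p /\ (p%:Z %| d)%Z) pram,
        (forall s : R[i], 1 < complex.Re s ->
          let F (p : nat) : R[i] := ((1 - cpow p (- s)) *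
                      (1 - (chi d p)%:~R * cpow p (- s)))^-1 in
          let Fram (p : nat) : R[i] := (1 - cpow p (- s))^-1 in
          let Finert (p : nat) : R[i] := (1 - cpow p (- (2 * s)))^-1 in
          let Fsplit (p : nat) : R[i] := ((1 - cpow p (- s)) ^+ 2)^-1 in
          [/\ [/\ cvgn (dirichlet_series (num_ssl OK) s),
                  cvgn (dirichlet_series (num_ideals OK) s)
                & D_ssl OK s = dedekind_zeta OK s],
              [/\ cvgn (euler_product xpredT F)
                & dedekind_zeta OK s = prime_prod xpredT F]
            & [/\ cvgn (euler_product (ramifies d) Fram),
                  cvgn (euler_product (inert d) Finert),
                  cvgn (euler_product (splits d) Fsplit)
                & prime_prod xpredT F
                  = prime_prod (ramifies d) Fram
                    * prime_prod (inert d) Finert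
                    * prime_prod (splits d) Fsplit]]),
        (forall s : R[i], 1 < complex.Re s ->
          let Fpr (p : nat) : R[i] := (1 + cpow p (- s)) / (1 - cpow p (- s)) in
          [/\ cvgn (dirichlet_series (num_primitive_ssl OK) s),
              zeta (2 * s) != 0,
              D_primitive_ssl OK s = D_ssl OK s / zeta (2 * s),
              cvgn (euler_product (splits d) Fpr)
            & D_ssl OK s / zeta (2 * s)
              = (1 + cpow pram (- s)) * prime_prod (splits d) Fpr])
      & (forall G : set R[i], planar_lattice G -> similar_lattices OK G ->
          forall s : R[i], 1 < complex.Re s ->
            [/\ cvgn (dirichlet_series (num_ssl G) s),
                cvgn (dirichlet_series (num_primitive_ssl G) s),
                D_ssl G s = D_ssl OK s
              & D_primitive_ssl G s = D_primitive_ssl OK s])].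
Proof.
have [t [n [dE d_lt0 tn disc_gt0 small_primes]]] := class_one_discriminants hd.
rewrite {}dE in d_lt0 *.
have w_trace : omega R t n + (omega R t n)^*%C = t%:~R := omega_trace R tn d_lt0.
have w_norm := omega_norm R tn d_lt0.
rewrite (ring_of_integersE R tn d_lt0).
set w := omega R t n in w_trace w_norm *.
set d' := t - 4 * n.
move=> OK; pose f := num_principal w.
have gOK : additive_subgroup OK := order_subgroup w.
have hecke p m : prime p -> (0 < m)%N ->
    (f (p * m))%:Z = (1 + chi d' p) * (f m)%:Z - chi d' p * (coef_shift p f m)%:Z.
  by move=> pp m0; exact: (hecke_principal w_trace w_norm tn disc_gt0 small_primes).
have f1 : f 1 = 1%N := num_principal1 w_trace w_norm.
have chi_val := chi_values t n.
have chi1 p : prime p -> `|chi d' p| <= 1 by move=> /chi_val[] ->.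
have sslE m : (0 < m)%N -> num_ssl OK m = f m.
  by move=> m0; rewrite /num_ssl (ssl_principal w_trace w_norm disc_gt0 m0).
have idealE m : (0 < m)%N -> num_ideals OK m = f m.
  by move=> m0; rewrite /num_ideals (ideal_principal w_trace w_norm disc_gt0 small_primes m0).
pose fpr k m := num_sets (primitive_upto w k m).
have primE m : (0 < m)%N -> num_primitive_ssl OK m = num_sets (primitive_principal w m).
  by move=> m0; rewrite /num_primitive_ssl (primitive_ssl_principal w_trace w_norm disc_gt0 m0).
have [q qP] := unique_prime_divisor tn.
have ram_q p : (prime p && ramifies d' p) = (p == q).
  by rewrite -qP; case: (boolP (prime p)) => //= pp; exact: ramifiesE.
have cvg_f (s : R[i]) : 1 < complex.Re s -> @cvg_wt R f (complex.Re s).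
  exact: (cvg_wt_hecke chi1 f1 hecke).
have ssl_cvg (s : R[i]) : 1 < complex.Re s -> cvgn (dirichlet_series (num_ssl OK) s).
  by move=> s1; rewrite (eq_dirichlet s sslE); exact: cvg_dirichlet (cvg_f _ s1).
have sslD (s : R[i]) : D_ssl OK s = dirichlet_sum f s by exact: eq_dirichlet_sum.
have prim (s : R[i]) : 1 < complex.Re s -> [/\ cvgn (dirichlet_series (num_primitive_ssl OK) s),
    zeta (2 * s) != 0 & D_primitive_ssl OK s = dirichlet_sum f s / zeta (2 * s)].
  move=> s1; apply: (hecke_primitive chi1 f1 hecke (fpr := fpr) s1).
  - by move=> m m0; rewrite /fpr primitive_upto0.
  - move=> k m m0; apply: num_sets_le; first exact: (finite_principal w_trace w_norm disc_gt0).
    by move=> L [].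
  - move=> k m mk; rewrite primE; last by case/andP: mk.
    by rewrite /fpr (primitive_upto_gt w_trace w_norm disc_gt0 mk).
  - by move=> k m m0 npk; rewrite /fpr primitive_upto_nonprime.
  - move=> p m m0 pp; exact: (primitive_upto_prime w_trace w_norm disc_gt0 pp m0).
have euler (s : R[i]) (s1 : 1 < complex.Re s) :=
  euler_formulas chi_val ram_q s1 (hecke_euler chi1 f1 hecke s1).
have uniq_q (P : pred nat) : (forall p, (prime p && P p) = (p == q)) ->
    unique (fun p : nat => prime p /\ P p) q.
  move=> Pq; split; first by apply/andP; rewrite Pq.
  by move=> p /andP; rewrite Pq => /eqP.
exists q; split.
- exact: uniq_q ram_q.
- exact: (uniq_q (fun p => (p%:Z %| d')%Z) qP).
- move=> s s1; have [r [i [sp [pr [[cr ci cs] cF DE _ _]]]]] := euler s s1.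
  move=> F Fram Finert Fsplit.
  have lim_eq (u : nat -> R[i]) (l : R[i]) : u @ \oo --> l -> limn u = l.
    by move=> ul; apply: cvg_lim; [exact: (@norm_hausdorff _ R[i]^o)|exact: ul].
  have zE : dedekind_zeta OK s = dirichlet_sum f s by exact: eq_dirichlet_sum.
  split; split.
  + exact: ssl_cvg.
  + by rewrite (eq_dirichlet s idealE); exact: cvg_dirichlet (cvg_f _ s1).
  + by rewrite sslD zE.
  + by apply/cvg_ex; exists (r * i * sp); exact: cF.
  + by rewrite zE DE /prime_prod (lim_eq _ _ cF).
  + by apply/cvg_ex; exists r; exact: cr.
  + by apply/cvg_ex; exists i; exact: ci.
  + by apply/cvg_ex; exists sp; exact: cs.
  + by rewrite /prime_prod (lim_eq _ _ cF) (lim_eq _ _ cr) (lim_eq _ _ ci) (lim_eq _ _ cs).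
- move=> s s1; have [r [i [sp [pr [_ _ _ cpr DE]]]]] := euler s s1.
  have [pc z0 pD] := prim s s1.
  move=> Fpr; split.
  + exact: pc.
  + exact: z0.
  + by rewrite sslD.
  + by apply/cvg_ex; exists pr; exact: cpr.
  + rewrite sslD DE; congr (_ * _); apply/esym; apply: cvg_lim; last exact: cpr.
    exact: (@norm_hausdorff _ R[i]^o).
- move=> G _ [a a0 GE] s s1; have [pc _ _] := prim s s1.
  have sslG : num_ssl G = num_ssl OK by apply/funext => m; rewrite GE num_ssl_dilate.
  have primG : num_primitive_ssl G = num_primitive_ssl OK.
    by apply/funext => m; rewrite GE num_primitive_ssl_dilate.
  rewrite /D_ssl /D_primitive_ssl sslG primG; split.
  + exact: ssl_cvg.
  + exact: pc.
  + by [].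
  + by [].
Qed.
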